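(* Let $F_u(G,\Delta)$ be the uncertain system with actuator uncertainty $\dot x_G=f(x_G,w,d)+g(x_G,w,d)u$, $v=h(x_G,w,d,u)$, $w=\Delta(v)$ on $[0,T]$, and let $F,H$ be the maps of the extended system with state $x=[x_G;x_\psi]\in\mathbb{R}^n$, $n=n_G+n_\psi$, as defined in the context. Let $T>0$, $R>0$, $\gamma\in\mathbb{R}$, $X_T\subset\mathbb{R}^{n_G}$, $P\in\mathbb{R}^{n_p\times n_u}$, $b\in\mathbb{R}^{n_p}$ be given, with control constraint set $U=\{u\in\mathbb{R}^{n_u}:Pu\le b\}$, and let the disturbances satisfy $\|d\|_{2,[0,T]}<R$. Let $\Psi$ and $M\in\mathbb{S}^{n_z}$ be given and assume that $\Delta$ satisfies the soft IQC defined by $(\Psi,M)$. Suppose there exist a $\mathcal{C}^1$ function $V:\mathbb{R}\times\mathbb{R}^{n}\times\mathbb{R}^{n_u}\to\mathbb{R}$, a matrix $Y_{22}\in\mathbb{S}^{n_\psi}$ satisfying $$\begin{bmatrix}A_\psi^\top Y_{22}+Y_{22}A_\psi & Y_{22}B_{\psi2}\\ B_{\psi2}^\top Y_{22}&0\end{bmatrix}+\begin{bmatrix}C_\psi& D_{\psi2}\end{bmatrix}^\top M\begin{bmatrix}C_\psi& D_{\psi2}\end{bmatrix}<0,$$ and a control law $\tilde k:\mathbb{R}\times\mathbb{R}^{n_G}\times\mathbb{R}^{n_u}\to\mathbb{R}^{n_u}$ such that, with $\mathcal{V}(t,x,\tilde x):=V(t,x,\tilde x)-x_\psi^\top Y_{22}x_\psi$: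 (i) for all $(t,x,\tilde x,w,d)\in[0,T]\times\mathbb{R}^n\times\mathbb{R}^{n_u}\times\mathbb{R}^{n_w}\times\mathbb{R}^{n_d}$ with $\mathcal{V}(t,x,\tilde x)\le\gamma+R^2$, $$\partial_tV(t,x,\tilde x)+\partial_xV(t,x,\tilde x)\cdot F(x,w,d,\tilde x)+\partial_{\tilde x}V(t,x,\tilde x)\cdot\tilde k(t,x_G,\tilde x)+z^\top Mz\le d^\top d,$$ where $z=H(x,w,d,\tilde x)$; (ii) for every $(x_\psi,\tilde x)\in\mathbb{R}^{n_\psi}\times U$, $\{x_G\in\mathbb{R}^{n_G}:\mathcal{V}(T,[x_G;x_\psi],\tilde x)\le\gamma+R^2\}\subseteq X_T$; (iii) for every $i=1,\dots,n_p$ and all $(t,x,\tilde x)\in[0,T]\times\mathbb{R}^n\times\mathbb{R}^{n_u}$ with $\mathcal{V}(t,x,\tilde x)\le\gamma+R^2$, $P_i\tilde x\le b_i$, where $P_i$ is the $i$-th row of $P$. Then the intersection of $\Omega^V_{0,\gamma}=\{(x,\tilde x):V(0,x,\tilde x)\le\gamma\}$ with the hyperplane $(x_\psi,\tilde x)=0$, i.e. the set $\{\xi\in\mathbb{R}^{n_G}:V(0,[\xi;0],0)\le\gamma\}$, is an inner-approximation to $BRS(T,X_T,U,R,F_u(G,\Delta))$ under the dynamic controller $$\dot{\tilde x}(t)=\tilde k(t,x_G(t),\tilde x(t)),\qquad u(t)=\tilde x(t),\qquad \tilde x(0)=0.$$ That is, for every $\xi$ in this set and every $d$ with $\|d\|_{2,[0,T]}<R$,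 the solution of the uncertain system in closed loop with this controller, with $x_G(0)=\xi$, satisfies $u(t)\in U$ for all $t\in[0,T]$ and $x_G(T)\in X_T$.
   Context: Signals and norms. $\mathcal{L}_2^{m}$ is the space of measurable $r:[0,\infty)\to\mathbb{R}^m$ with $\int_0^\infty r^\top r\,dt<\infty$; $\|r\|_{2,[0,T]}=(\int_0^T r(t)^\top r(t)\,dt)^{1/2}$, and $r\in\mathcal{L}_2^m[0,T]$ if this is finite. $\mathbb{S}^m$ denotes the real symmetric $m\times m$ matrices; for symmetric matrices $<0$ means negative definite. $\mathbb{RH}_\infty$ denotes rational functions with real coefficients that are analytic in the closed right half plane (stable transfer functions). Uncertain system $F_u(G,\Delta)$ with actuator uncertainty. State $x_G(t)\in\mathbb{R}^{n_G}$, control $u(t)\in U\subseteq\mathbb{R}^{n_u}$, disturbance $d(t)\in\mathbb{R}^{n_d}$, and $v(t)\in\mathbb{R}^{n_v}$, $w(t)\in\mathbb{R}^{n_w}$ the input and output of the perturbation $\Delta$. The maps $f:\mathbb{R}^{n_G}\times\mathbb{R}^{n_w}\times\mathbb{R}^{n_d}\to\mathbb{R}^{n_G}$, $g:\mathbb{R}^{n_G}\times\mathbb{R}^{n_w}\times\mathbb{R}^{n_d}\to\mathbb{R}^{n_G\times n_u}$, $h:\mathbb{R}^{n_G}\times\mathbb{R}^{n_w}\times\mathbb{R}^{n_d}\times\mathbb{R}^{n_u}\to\mathbb{R}^{n_v}$ define the nominal system $G$; $v$ may depend directly on $u$. $\Delta:\mathcal{L}_2^{n_v}\to\mathcal{L}_2^{n_w}$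 is a bounded, causal operator. Solutions. $x_G(t;\xi,u,d)$, $0\le t\le T$, denotes the solution of the uncertain system with initial condition $\xi$, control $u$ and disturbance $d$. Solutions (including those of the closed loop with a dynamic controller) are understood to exist on $[0,T]$: the states are absolutely continuous and satisfy the differential equations almost everywhere, $v\in\mathcal{L}_2^{n_v}[0,T]$, $w\in\mathcal{L}_2^{n_w}[0,T]$, and $w=\Delta(v)$ on $[0,T]$ (by causality, $v$ may be extended by zero beyond $T$). Statements about ''the solution'' apply to every such solution. Backward reachable set. $BRS(T,X_T,U,R,F_u(G,\Delta))$ is the set of $\xi\in\mathbb{R}^{n_G}$ for which there is a control $u$ with $u(t)\in U$ for all $t\in[0,T]$ and $x_G(T;\xi,u,d)\in X_T$ for all $d$ with $\|d\|_{2,[0,T]}<R$. Here the control may be given by (dynamic) feedback. Filter. $\Psi\in\mathbb{RH}_\infty^{n_z\times(n_v+n_w)}$ is a stable LTI system ($A_\psi$ Hurwitz) driven by $(v,w)$ with state $x_\psi(t)\in\mathbb{R}^{n_\psi}$, zero initial condition $x_\psi(0)=0$, and $\dot x_\psi=A_\psi x_\psi+B_{\psi1}v+B_{\psi2}w$, $z=C_\psi x_\psi+D_{\psi1}v+D_{\psi2}w\in\mathbb{R}^{n_z}$. Soft IQC. $\Delta$ satisfies the soft IQC defined by $(\Psi,M)$, $M\in\mathbb{S}^{n_z}$, if for all $v\in\mathcal{L}_2^{n_v}$ and $w=\Delta(v)$ the filter output $z$ satisfies $\int_0^\infty z(\tau)^\top Mz(\tau)\,d\tau\ge0$. Extended system.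 With $x=[x_G;x_\psi]\in\mathbb{R}^n$, the interconnection of $G$ and $\Psi$ is $\dot x=F(x,w,d,u)$, $z=H(x,w,d,u)$, where $F(x,w,d,u)=\begin{bmatrix} f(x_G,w,d)+g(x_G,w,d)u\\ A_\psi x_\psi+B_{\psi1}h(x_G,w,d,u)+B_{\psi2}w\end{bmatrix}$ and $H(x,w,d,u)=C_\psi x_\psi+D_{\psi1}h(x_G,w,d,u)+D_{\psi2}w$. The variable $\tilde x\in\mathbb{R}^{n_u}$ is the auxiliary controller state, which equals the control command $u$. *)

(* Defs.v *)
From HB Require Import structures.
From mathcomp Require Import all_boot all_order all_algebra.
From mathcomp Require Import complex.
From mathcomp Require Import all_classical all_reals all_analysis.

Set Implicit Arguments.
Unset Strict Implicit.
Unset Printing Implicit Defensive.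

Import Order.TTheory GRing.Theory Num.Theory.
Import numFieldNormedType.Exports.

Local Open Scope classical_set_scope.
Local Open Scope ring_scope.

Definition qform (R : realType) (n : nat) (A : 'M[R]_n) (z : 'cV[R]_n) : R :=
  (z^T *m A *m z) 0 0.

Definition sqnorm (R : realType) (n : nat) (z : 'cV[R]_n) : R := (z^T *m z) 0 0.

Definition neg_def (R : realType) (n : nat) (A : 'M[R]_n) : Prop :=
  A^T = A /\ forall z : 'cV[R]_n, z != 0 -> qform A z < 0.

Definition hurwitz (R : realType) (n : nat) (A : 'M[R]_n) : Prop :=
  forall l : complex R,
    eigenvalue (map_mx (real_complex R) A) l -> complex.Re l < 0.

(* In finite dimension, continuity of p |-> 'd F p v for each fixed v is
   continuity of p |-> 'd F p for the operator norm. *)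
Definition C1 (R : realType) (U W : normedModType R) (F : U -> W) : Prop :=
  (forall p : U, differentiable F p) /\
  (forall v : U, continuous (fun p : U => 'd F p v : W)).

Definition abs_cont (R : realType) (n : nat) (a b : R) (x : R -> 'cV[R]_n) : Prop :=
  forall e : R, 0 < e -> exists2 delta : R, 0 < delta &
    forall (m : nat) (I : 'I_m -> R * R),
      (forall i, [/\ a <= (I i).1, (I i).1 <= (I i).2 & (I i).2 <= b]) ->
      trivIset setT (fun i => `](I i).1, (I i).2[%classic) ->
      \sum_(i < m) ((I i).2 - (I i).1) < delta ->
      \sum_(i < m) `|x (I i).2 - x (I i).1| < e.

(* A signal is a function on the whole line of which only the values on the
   time interval D matter.  Measurability is Borel measurability; every
   Lebesgue measurable signal has a Borel representative, and the equations
   imposed on signals below only hold almost everywhere. *)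
Definition L2norm (R : realType) (D : set R) (n : nat) (r : R -> 'cV[R]_n) : \bar R :=
  sqrte (\int[@lebesgue_measure R]_(t in D) (sqnorm (r t))%:E)%E.

Definition L2 (R : realType) (D : set R) (n : nat) (r : R -> 'cV[R]_n) : Prop :=
  (forall i : 'I_n, measurable_fun D (fun t => r t i 0)) /\
  (L2norm D r < +oo)%E.

Definition half_line (R : realType) : set R := `[0, +oo[%classic.
Arguments half_line {R}.

Definition truncation (R : realType) (T : R) (n : nat) (r : R -> 'cV[R]_n) : R -> 'cV[R]_n :=
  fun t => if 0 <= t <= T then r t else 0.

(* The second clause makes Delta well defined on L2 classes. *)
Definition bounded_causal_operator (R : realType) (nv nw : nat)
    (Delta : (R -> 'cV[R]_nv) -> (R -> 'cV[R]_nw)) : Prop :=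
  [/\ forall v, L2 half_line v -> L2 half_line (Delta v),
      forall v1 v2, L2 half_line v1 -> L2 half_line v2 ->
        {ae @lebesgue_measure R, forall t : R, 0 <= t -> v1 t = v2 t} ->
        {ae @lebesgue_measure R, forall t : R, 0 <= t -> Delta v1 t = Delta v2 t},
      exists C : R, forall v, L2 half_line v ->
        (L2norm half_line (Delta v) <= C%:E * L2norm half_line v)%E
    & forall (T : R) v, 0 <= T -> L2 half_line v ->
        {ae @lebesgue_measure R, forall t : R, 0 <= t <= T ->
           Delta v t = Delta (truncation T v) t}].

Record plant (R : realType) (nG nu nd nv nw : nat) := Plant {
  pl_f : 'cV[R]_nG -> 'cV[R]_nw -> 'cV[R]_nd -> 'cV[R]_nG;
  pl_g : 'cV[R]_nG -> 'cV[R]_nw -> 'cV[R]_nd -> 'M[R]_(nG, nu);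
  pl_h : 'cV[R]_nG -> 'cV[R]_nw -> 'cV[R]_nd -> 'cV[R]_nu -> 'cV[R]_nv }.

Record lti_filter (R : realType) (npsi nv nw nz : nat) := LtiFilter {
  psi_A : 'M[R]_npsi;
  psi_B1 : 'M[R]_(npsi, nv);
  psi_B2 : 'M[R]_(npsi, nw);
  psi_C : 'M[R]_(nz, npsi);
  psi_D1 : 'M[R]_(nz, nv);
  psi_D2 : 'M[R]_(nz, nw) }.

Definition psi_rhs (R : realType) (npsi nv nw nz : nat)
    (Psi : lti_filter R npsi nv nw nz)
    (x : 'cV[R]_npsi) (v : 'cV[R]_nv) (w : 'cV[R]_nw) : 'cV[R]_npsi :=
  psi_A Psi *m x + psi_B1 Psi *m v + psi_B2 Psi *m w.

Definition psi_out (R : realType) (npsi nv nw nz : nat)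
    (Psi : lti_filter R npsi nv nw nz)
    (x : 'cV[R]_npsi) (v : 'cV[R]_nv) (w : 'cV[R]_nw) : 'cV[R]_nz :=
  psi_C Psi *m x + psi_D1 Psi *m v + psi_D2 Psi *m w.

Definition psi_trajectory (R : realType) (npsi nv nw nz : nat)
    (Psi : lti_filter R npsi nv nw nz)
    (v : R -> 'cV[R]_nv) (w : R -> 'cV[R]_nw) (x : R -> 'cV[R]_npsi) : Prop :=
  [/\ x 0 = 0,
      forall T : R, 0 < T -> abs_cont 0 T x
    & {ae @lebesgue_measure R, forall t : R, 0 <= t ->
         is_derive t 1 x (psi_rhs Psi (x t) (v t) (w t))}].

Definition soft_IQC (R : realType) (npsi nv nw nz : nat)
    (Psi : lti_filter R npsi nv nw nz) (M : 'M[R]_nz)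
    (Delta : (R -> 'cV[R]_nv) -> (R -> 'cV[R]_nw)) : Prop :=
  forall v, L2 half_line v ->
  forall x : R -> 'cV[R]_npsi, psi_trajectory Psi v (Delta v) x ->
    (0 <= \int[@lebesgue_measure R]_(t in half_line)
            (qform M (psi_out Psi (x t) (v t) (Delta v t)))%:E)%E.

(* The extended state is x = col_mx xG xpsi. *)
Definition ext_F (R : realType) (nG nu nd nv nw npsi nz : nat)
    (G : plant R nG nu nd nv nw) (Psi : lti_filter R npsi nv nw nz)
    (x : 'cV[R]_(nG + npsi)) (w : 'cV[R]_nw) (d : 'cV[R]_nd) (u : 'cV[R]_nu) :
    'cV[R]_(nG + npsi) :=
  col_mx (pl_f G (usubmx x) w d + pl_g G (usubmx x) w d *m u)
         (psi_rhs Psi (dsubmx x) (pl_h G (usubmx x) w d u) w).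

Definition ext_H (R : realType) (nG nu nd nv nw npsi nz : nat)
    (G : plant R nG nu nd nv nw) (Psi : lti_filter R npsi nv nw nz)
    (x : 'cV[R]_(nG + npsi)) (w : 'cV[R]_nw) (d : 'cV[R]_nd) (u : 'cV[R]_nu) :
    'cV[R]_nz :=
  psi_out Psi (dsubmx x) (pl_h G (usubmx x) w d u) w.

Definition filter_LMI (R : realType) (npsi nv nw nz : nat)
    (Psi : lti_filter R npsi nv nw nz) (M : 'M[R]_nz) (Y : 'M[R]_npsi) : Prop :=
  neg_def (block_mx ((psi_A Psi)^T *m Y + Y *m psi_A Psi) (Y *m psi_B2 Psi)
                    ((psi_B2 Psi)^T *m Y) 0
           + (row_mx (psi_C Psi) (psi_D2 Psi))^T *m M
               *m row_mx (psi_C Psi) (psi_D2 Psi)).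

(* Time-varying dynamic state feedback
     xc' = ctrl_rhs t xG xc,  u = ctrl_out t xG xc,  xc 0 = ctrl_init;
   ctrl_dim = 0 covers open-loop controls and static feedback. *)
Record controller (R : realType) (nG nu : nat) := Controller {
  ctrl_dim : nat;
  ctrl_rhs : R -> 'cV[R]_nG -> 'cV[R]_ctrl_dim -> 'cV[R]_ctrl_dim;
  ctrl_out : R -> 'cV[R]_nG -> 'cV[R]_ctrl_dim -> 'cV[R]_nu;
  ctrl_init : 'cV[R]_ctrl_dim }.

Definition integrated_controller (R : realType) (nG nu : nat)
    (k : R -> 'cV[R]_nG -> 'cV[R]_nu -> 'cV[R]_nu) : controller R nG nu :=
  @Controller R nG nu nu k (fun _ _ xc => xc) 0.

Definition admissible_dist (R : realType) (nd : nat) (T rad : R) (d : R -> 'cV[R]_nd) : Prop :=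
  L2 `[0, T]%classic d /\ (L2norm `[0%R, T]%classic d < rad%:E)%E.

(* Two-sided derivatives are harmless here: the end points of [0, T] form a
   null set. *)
Definition solution (R : realType) (nG nu nd nv nw : nat)
    (G : plant R nG nu nd nv nw) (Delta : (R -> 'cV[R]_nv) -> (R -> 'cV[R]_nw))
    (T : R) (K : controller R nG nu) (xi : 'cV[R]_nG) (d : R -> 'cV[R]_nd)
    (xG : R -> 'cV[R]_nG) (xc : R -> 'cV[R]_(ctrl_dim K)) : Prop :=
  let u t := ctrl_out t (xG t) (xc t) in
  [/\ xG 0 = xi /\ xc 0 = ctrl_init K,
      abs_cont 0 T xG /\ abs_cont 0 T xc
    & exists (v : R -> 'cV[R]_nv) (w : R -> 'cV[R]_nw),
      [/\ L2 `[0, T]%classic v,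
          L2 `[0, T]%classic w,
          {ae @lebesgue_measure R, forall t : R, 0 <= t <= T ->
             w t = Delta (truncation T v) t}
        & {ae @lebesgue_measure R, forall t : R, 0 <= t <= T ->
             [/\ is_derive t 1 xG (pl_f G (xG t) (w t) (d t)
                                   + pl_g G (xG t) (w t) (d t) *m u t),
                 v t = pl_h G (xG t) (w t) (d t) (u t)
               & is_derive t 1 xc (ctrl_rhs t (xG t) (xc t))]}]].

Definition BRS_under (R : realType) (nG nu nd nv nw : nat)
    (T : R) (XT : set 'cV[R]_nG) (U : set 'cV[R]_nu) (rad : R)
    (G : plant R nG nu nd nv nw) (Delta : (R -> 'cV[R]_nv) -> (R -> 'cV[R]_nw))
    (K : controller R nG nu) : set 'cV[R]_nG :=
  [set xi | forall d, admissible_dist T rad d ->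
            forall xG xc, solution G Delta T (K := K) xi d xG xc ->
              (forall t : R, 0 <= t <= T -> U (ctrl_out t (xG t) (xc t))) /\
              XT (xG T)].

Definition closed_loop_exists (R : realType) (nG nu nd nv nw : nat)
    (T rad : R)
    (G : plant R nG nu nd nv nw) (Delta : (R -> 'cV[R]_nv) -> (R -> 'cV[R]_nw))
    (K : controller R nG nu) (xi : 'cV[R]_nG) : Prop :=
  forall d : R -> 'cV[R]_nd, admissible_dist T rad d ->
    exists xG xc, solution G Delta T (K := K) xi d xG xc.

(* Without the existence clause, a controller whose closed loop has no
   solution would put every xi in the set. *)
Definition BRS (R : realType) (nG nu nd nv nw : nat)
    (T : R) (XT : set 'cV[R]_nG) (U : set 'cV[R]_nu) (rad : R)
    (G : plant R nG nu nd nv nw) (Delta : (R -> 'cV[R]_nv) -> (R -> 'cV[R]_nw)) :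
    set 'cV[R]_nG :=
  [set xi | exists2 K : controller R nG nu,
      closed_loop_exists T rad G Delta K xi &
      BRS_under T XT U rad G Delta K xi].

(* Main.v *)
(* Along the closed loop, the chain rule for V and the dissipation inequality
   give V(t) + int_0^t z^T M z <= V(0) + int_0^t |d|^2 as long as calV stays
   below gamma + rad^2. The soft IQC is turned into the bound
   int_0^t z^T M z >= - xpsi(t)^T Y22 xpsi(t) at every time t by truncating v at
   time t: by causality nothing changes before t, and after t the LMI bounds the
   tail of the integral by the decrease of xpsi^T Y22 xpsi, which ends at 0 since
   the filter is stable. Hence calV(t) <= gamma + int_0^t |d|^2 < gamma + rad^2,
   so the sublevel set is never left.

   The trajectories are only absolutely continuous, so increments are compared
   with Lebesgue integrals through the fact that an absolutely continuous
   function with almost everywhere nonpositive derivative is nonincreasing. The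
   filter state is obtained by variation of constants, and it is square
   integrable by a Lyapunov function coming from the Schur form. *)
Require Import Defs.
From mathcomp Require Import all_boot all_order all_algebra.
From mathcomp Require Import complex spectral ring lra.
From mathcomp Require Import all_classical all_reals all_analysis measurable_realfun.

Set Implicit Arguments.
Unset Strict Implicit.
Unset Printing Implicit Defensive.

Import Order.TTheory GRing.Theory Num.Theory.
Import numFieldNormedType.Exports.

Local Open Scope classical_set_scope.
Local Open Scope ring_scope.

(** * Absolutely continuous functions *)

(** Condition (i) is available only inside the sublevel set, so no estimate can be integrated over
    [0, T] at once: time is advanced by real induction, and the strict bound on the energy of [d]
    provides the room for each advance. The same induction replaces covering and compactness
    arguments elsewhere. A solution carries no filter state and fixes [v] only on [0, T]; the filter
    is therefore driven by the truncation of [v] at T and its image under [Delta], both square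
    integrable on the half-line. An explicit response is needed because the soft IQC speaks only of
    given trajectories. Continuity of the differential is known direction by direction, so composing
    [V] with an absolutely continuous curve requires a local operator bound, which comes from finite
    dimension. The Schur form is complex while the Lyapunov matrix must be real, so real and
    imaginary parts are tracked separately. *)

(** The infimum of the failures is not a failure, by the first or the third clause; the second
    clause then keeps failures away on its right, so it is not their infimum. *)
Lemma real_induction (R : realType) (a b : R) (Q : R -> Prop) :
  Q a ->
  (forall t, a <= t < b -> (forall s, a <= s <= t -> Q s) ->
    exists2 t', t < t' & forall s, t < s < t' -> s <= b -> Q s) ->
  (forall t, a < t <= b -> (forall s, a <= s < t -> Q s) -> Q t) ->
  forall t, a <= t <= b -> Q t.
Proof.
move=> Qa Qr Ql t tab; apply: contrapT => Qt.
pose E := [set s | a <= s <= b /\ ~ Q s].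
have hE : has_inf E.
  by split; [exists t | exists a => s [/andP[]]].
have am : a <= inf E by apply: lb_le_inf; [exists t | move=> s [/andP[]]].
have mb x : E x -> inf E <= x by move=> Ex; apply: ge_inf => //; case: hE.
have below s : a <= s < inf E -> Q s.
  move=> /andP[as_ sm]; apply: contrapT => Qs.
  have Es : E s.
    by split=> //; rewrite as_ (le_trans (ltW sm))// (le_trans (mb t _))//; case/andP: tab.
  by have := mb _ Es; rewrite leNgt sm.
have mtb : inf E <= b by rewrite (le_trans (mb t _))//; case/andP: tab.
have Qm : Q (inf E).
  move: am; rewrite le_eqVlt => /predU1P[<-//|am].
  by apply: Ql => //; rewrite am mtb.
have {}mb x : E x -> inf E < x.
  move=> Ex; rewrite lt_neqAle mb// andbT; apply/eqP => mx.
  by case: Ex => _; rewrite -mx.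
have [||t' mt' Qt'] := Qr (inf E).
- by rewrite am (lt_le_trans (mb t _))//; case/andP: tab.
- move=> s /andP[as_]; rewrite le_eqVlt => /predU1P[->//|sm].
  by apply: below; rewrite as_.
have d0 : 0 < t' - inf E by rewrite subr_gt0.
have [x Ex xt'] := inf_adherent d0 hE.
have [/andP[_ xb] nQ] := Ex; apply: nQ; apply: Qt' => //.
by rewrite mb//=; move: xt'; rewrite addrC subrK.
Qed.

(** [abs_cont] with values in any normed space, so that real functions and pairs are covered; on
    column vectors the two agree by unfolding. *)
Definition ac_on (R : realType) (W : normedModType R) (a b : R) (x : R -> W) :=
  forall e : R, 0 < e -> exists2 delta : R, 0 < delta &
    forall (m : nat) (I : 'I_m -> R * R),
      (forall i, [/\ a <= (I i).1, (I i).1 <= (I i).2 & (I i).2 <= b]) ->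
      trivIset setT (fun i => `](I i).1, (I i).2[%classic) ->
      \sum_(i < m) ((I i).2 - (I i).1) < delta ->
      \sum_(i < m) `|x (I i).2 - x (I i).1| < e.

(** The closure properties below (sums, products, pairs, Lipschitz images) all reduce to such a
    bound on increments. [K] may have any sign, hence the constant |K| + 1 in the proof. *)
Lemma ac_on_dominated (R : realType) (W W1 W2 : normedModType R) (a b K : R)
    (f : R -> W) (g : R -> W1) (h : R -> W2) :
  ac_on a b g -> ac_on a b h ->
  (forall s t, a <= s -> s <= t -> t <= b ->
    `|f t - f s| <= K * (`|g t - g s| + `|h t - h s|)) ->
  ac_on a b f.
Proof.
move=> acg ach dom e e0.
pose C := `|K| + 1; have C0 : 0 < C by rewrite ltr_wpDl.
have e20 : 0 < e / (2 * C) by rewrite divr_gt0// mulr_gt0.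
have [d1 d10 H1] := acg _ e20; have [d2 d20 H2] := ach _ e20.
exists (Num.min d1 d2) => [|m I Iab tI]; first by rewrite lt_min d10.
rewrite lt_min => /andP[I1 I2].
have {}H1 := H1 _ _ Iab tI I1; have {}H2 := H2 _ _ Iab tI I2.
apply: (@le_lt_trans _ _ (C * (\sum_(i < m) `|g (I i).2 - g (I i).1| +
    \sum_(i < m) `|h (I i).2 - h (I i).1|))).
  rewrite -big_split/= mulr_sumr; apply: ler_sum => i _.
  have [? ? ?] := Iab i; apply: le_trans (dom _ _ _ _ _) _ => //.
  by apply: ler_wpM2r; rewrite ?addr_ge0// (le_trans (ler_norm _))// lerDl.
have -> : e = C * (e / (2 * C) + e / (2 * C)) by field; rewrite gt_eqF.
by rewrite ltr_pM2l// ltrD.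
Qed.

Lemma ac_on_sub (R : realType) (W : normedModType R) (a b a' b' : R) (f : R -> W) :
  a <= a' -> b' <= b -> ac_on a b f -> ac_on a' b' f.
Proof.
move=> aa bb acf e e0; have [d d0 H] := acf _ e0; exists d => // m I Iab.
by apply: H => i; have [? ? ?] := Iab i; split=> //; lra.
Qed.

Lemma ac_on_unif (R : realType) (W : normedModType R) (a b : R) (f : R -> W) :
  ac_on a b f -> forall e, 0 < e -> exists2 d, 0 < d &
    forall s t, a <= s <= b -> a <= t <= b -> `|t - s| < d -> `|f t - f s| < e.
Proof.
move=> acf e e0; have [d d0 H] := acf _ e0; exists d => // s t.
wlog st : s t / s <= t.
  move=> wl sab tab ts; have [st|/ltW st] := leP s t; first exact: wl.
  by rewrite distrC; apply: wl => //; rewrite distrC.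
move=> /andP[? ?] /andP[? ?]; rewrite ger0_norm ?subr_ge0// => ts.
have := H 1 (fun=> (s, t)); rewrite !big_ord1/=; apply => //.
by apply/trivIsetP => i j _ _; rewrite !ord1 eqxx.
Qed.

(* The intervals are listed from right to left. *)
Lemma ac_on_seq (R : realType) (W : normedModType R) (a b : R) (f : R -> W) :
  ac_on a b f -> forall e, 0 < e -> exists2 d, 0 < d &
    forall s : seq (R * R),
      all (fun i => [&& a <= i.1, i.1 <= i.2 & i.2 <= b]) s ->
      pairwise (fun i j => j.2 <= i.1) s ->
      \sum_(i <- s) (i.2 - i.1) < d -> \sum_(i <- s) `|f i.2 - f i.1| < e.
Proof.
move=> acf e e0; have [d d0 H] := acf _ e0; exists d => // s sab ps.
rewrite !(big_nth (0, 0)) !big_mkord; apply: H.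
  move=> i; have /and3P[] := allP sab _ (mem_nth (0, 0) (ltn_ord i)).
  by split.
apply/trivIsetP => i j _ _; wlog ij : i j / (i < j)%N.
  move=> wl ij; have [ij'|ij'|/val_inj ij'] := ltngtP i j; first exact: wl.
    by rewrite setIC; apply: wl => //; rewrite eq_sym.
  by rewrite ij' eqxx in ij.
move=> _; have := pairwiseP (0, 0) ps i j (ltn_ord i) (ltn_ord j) ij => /= le.
by rewrite -subset0 => x []/=; rewrite !in_itv/= => /andP[? ?] /andP[? ?]; lra.
Qed.

Lemma is_derive_slope (R : realType) (f : R -> R) (t l e : R) :
  is_derive t 1 f l -> 0 < e -> exists2 d, 0 < d &
    forall s, `|s - t| < d -> `|f s - f t - l * (s - t)| <= e * `|s - t|.
Proof.
move=> [df <-] e0; have := df; rewrite /derivable => /cvg_ex[/= L HL].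
have -> : 'D_1 f t = L by apply: cvg_lim.
move/cvgrPdist_le: HL => /(_ _ e0)[/= d d0 Hd].
exists d => // s sd; have [->|st] := eqVneq s t.
  by rewrite !subrr mulr0 subr0 normr0 mulr0.
have st0 : s - t != 0 by rewrite subr_eq0.
have := Hd (s - t); rewrite /ball_/= sub0r normrN => /(_ sd st0).
rewrite [_ *: 1]mulr1 subrK => H.
have -> : f s - f t - L * (s - t) = - ((s - t) * (L - (s - t)^-1 *: (f s - f t))).
  by rewrite /GRing.scale/=; field.
by rewrite normrN normrM mulrC ler_wpM2r.
Qed.

Lemma lebesgue_measure_le (R : realType) (A B : set R) :
  measurable A -> measurable B -> A `<=` B ->
  (lebesgue_measure A <= lebesgue_measure B)%E.
Proof. by move=> mA mB AB; apply: le_measure => //; exact: mem_set. Qed.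

(** Outer regularity, applied to a measurable null set containing [N], since [N] itself need not be
    measurable. *)
Lemma null_open_cover (R : realType) (N : set R) (d : R) :
  (@lebesgue_measure R).-negligible N -> 0 < d ->
  exists B : set R, [/\ open B, N `<=` B & (lebesgue_measure B < d%:E)%E].
Proof.
move=> [A [mA A0 NA]] d0.
have [|B [oO AO mO]] := lebesgue_regularity_outer mA _ d0; first by rewrite [ltLHS](_ : _ = 0%E).
exists B; split=> //; first exact: subset_trans AO.
have -> : B = A `|` (B `\` A) by rewrite setDUK.
rewrite measureU//; last 2 first.
- by apply: measurableD => //; exact: open_measurable.
- by rewrite setDE setICA setICr setI0.
by rewrite [X in (X + _)%E](_ : _ = 0%E) ?add0e.
Qed.

(** It suffices to bound f b - f a by an arbitrary e0 > 0, which is split into e (b - a) for the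
    slopes and e for the exceptional set. Real induction does the work of a Vitali covering. *)
Lemma ac_nonincreasing (R : realType) (a b : R) (f : R -> R) :
  a <= b -> ac_on a b f ->
  {ae @lebesgue_measure R, forall t, a <= t <= b ->
    exists2 l, l <= 0 & is_derive t 1 f l} ->
  f b <= f a.
Proof.
move=> ab acf aef; apply/ler_addgt0Pr => e0 e00.
have [e e_gt0 eE] : exists2 e, 0 < e & e0 = e * (b - a) + e.
  have ba : 0 < b - a + 1 by rewrite ltr_wpDl// subr_ge0.
  by exists (e0 / (b - a + 1)); [exact: divr_gt0 | field; rewrite gt_eqF].
have [d d0 Hd] := ac_on_seq acf e_gt0.
have [B [oO NO muO]] := null_open_cover aef d0.
pose mu := @lebesgue_measure R.
have mO c : measurable (B `&` `]a, c[%classic).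
  by apply: measurableI => //; exact: open_measurable.
(* Creep from a to b: at points outside B the slope is at most e, while inside
   B the increments of f are charged to disjoint intervals contained in B, whose
   total length stays below the delta of absolute continuity. *)
pose Q t := exists s : seq (R * R),
  [/\ all (fun i => [&& a <= i.1, i.1 <= i.2 & i.2 <= t]) s,
      pairwise (fun i j => j.2 <= i.1) s,
      ((\sum_(i <- s) (i.2 - i.1))%:E <= mu (B `&` `]a, t[%classic))%E &
      f t - f a <= e * (t - a) + \sum_(i <- s) `|f i.2 - f i.1| ].
have stepO s t : a <= s -> s <= t -> t <= b -> `]s, t[%classic `<=` B -> Q s -> Q t.
  move=> as_ st tb stO [r [rab pr mr fr]]; exists ((s, t) :: r); split.
  - rewrite /= as_ st lexx/=; apply/allP => i /(allP rab) /and3P[-> -> /=].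
    by move=> /le_trans; apply.
  - rewrite /= pr andbT; apply/allP => i /(allP rab) /and3P[_ _ //].
  - rewrite big_cons/= EFinD.
    apply: (@le_trans _ _ (mu `]s, t[%classic + mu (B `&` `]a, s[%classic))%E).
      apply: leeD => //; rewrite /mu lebesgue_measure_itv/= lte_fin.
      by case: ltP => [_|ts]; rewrite ?EFinB // -EFinB lee_fin subr_le0.
    rewrite -measureU; [|exact: measurable_itv|exact: mO|].
      apply: lebesgue_measure_le; [apply: measurableU; [exact: measurable_itv|exact: mO]|exact: mO|].
      move=> x [/= xst|[Bx /=]].
        by split; [exact: stO|]; move: xst; rewrite /= !in_itv/= => /andP[? ?]; lra.
      by rewrite !in_itv/= => xas; split=> //; lra.
    by rewrite -subset0 => x [/=]; rewrite in_itv/= => xst [_]; rewrite in_itv/=; lra.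
  - rewrite big_cons/=; have := ler_norm (f t - f s).
    have : 0 <= e * (t - s) by rewrite mulr_ge0 ?subr_ge0// ltW.
    by move: fr; set S := \sum_(_ <- _) _; nra.
have stepD s t : s <= t -> f t - f s <= e * (t - s) -> Q s -> Q t.
  move=> st fst [r [rab pr mr fr]]; exists r; split=> //.
  - by apply/allP => i /(allP rab) /and3P[-> -> /=] /le_trans; apply.
  - apply: le_trans mr _; apply: lebesgue_measure_le; [exact: mO|exact: mO|] => x [Ox].
    by rewrite /= in_itv/= => xs; split=> //; rewrite /= in_itv/=; lra.
  - by move: fst fr; set S := \sum_(_ <- _) _; nra.
(* Increments are taken with one end point at t, since a derivative at t does not control two nearby
   points on the same side. Off [B] a derivative l <= 0 exists, because [B] contains all exceptional
   times. *)
have near_t t : a <= t <= b -> exists2 n, 0 < n & forall s s', `|s - t| < n ->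
    `|s' - t| < n -> a <= s -> s <= s' -> s' <= b -> s = t \/ s' = t -> Q s -> Q s'.
  move=> tab; have [tO|tO] := pselect (B t).
    have [n /= n0 nO] := (@nbhs_ballP _ R^o _ _).1 (open_nbhs_nbhs (conj oO tO)).
    exists n => // s s' sn s'n as_ ss' s'b _; apply: stepO => // x.
    rewrite /= in_itv/= => xss'; apply: nO; rewrite /ball/=.
    move: sn s'n; rewrite !ltr_norml => /andP[? ?] /andP[? ?].
    by apply/andP; split; lra.
  have [l l0 dl] : exists2 l, l <= 0 & is_derive t 1 f l.
    by apply: contrapT => H; apply: tO; apply: NO => /=; move/(_ tab).
  have [n n0 Hn] := is_derive_slope dl e_gt0.
  exists n => // s s' sn s'n as_ ss' s'b [] est; apply: stepD => //.
    move: est ss' s'n => -> ts' /Hn.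
    rewrite (ger0_norm (_ : 0 <= s' - t)) ?subr_ge0// ler_norml => /andP[_].
    by have : l * (s' - t) <= 0; [rewrite mulr_le0_ge0// subr_ge0 | lra].
  move: est ss' sn => -> st /Hn.
  rewrite (ler0_norm (_ : s - t <= 0)) ?subr_le0// ler_norml => /andP[+ _].
  by have : 0 <= l * (s - t); [rewrite mulr_le0// subr_le0 | lra].
have Qb : Q b.
  apply: (@real_induction _ a b Q); last by rewrite ab lexx.
  - exists [::]; split=> //; rewrite !big_nil//.
    by rewrite !subrr mulr0 addr0.
  - move=> t /andP[at_ tb] Qt; have [|n n0 Hn] := near_t t; first by rewrite at_ ltW.
    exists (t + n); first by rewrite ltrDl.
    move=> s /andP[ts st] sb; apply: (Hn t s) => //.
    + by rewrite subrr normr0.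
    + by rewrite ger0_norm ?subr_ge0 ?ltW//; lra.
    + exact: ltW.
    + by left.
    + by apply: Qt; rewrite at_ lexx.
  - move=> t /andP[at_ tb] Qt; have [|n n0 Hn] := near_t t; first by rewrite tb ltW.
    have [s [as_ st sn]] : exists s, [/\ a <= s, s < t & t - s < n].
      exists (Num.max a (t - n / 2)); rewrite le_max lexx; split=> //.
        by rewrite gt_max at_/= ltrBlDr ltrDl divr_gt0.
      by rewrite ltrBlDr addrC -ltrBlDr lt_max; apply/orP; right; lra.
    apply: (Hn s t) => //.
    + by rewrite ltr0_norm ?subr_lt0//; lra.
    + by rewrite subrr normr0.
    + exact: ltW.
    + by right.
    + by apply: Qt; rewrite as_ st.
have [s [sab ps ms fs]] := Qb.
have : \sum_(i <- s) (i.2 - i.1) < d.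
  rewrite -lte_fin; apply: le_lt_trans ms (le_lt_trans _ muO).
  by apply: lebesgue_measure_le; [exact: mO|exact: open_measurable|move=> x []].
move=> /Hd -/(_ sab ps); rewrite eE; lra.
Qed.

(** Lets [filterS] and [filter_forall] act on almost-everywhere statements. *)
#[local] Instance lebesgue_ae_filter (R : realType) :
  Filter (nbhs (almost_everywhere (@lebesgue_measure R))).
Proof. exact: (ae_filter_ringOfSetsType (@lebesgue_measure R)). Qed.

(** The integral of |g| over a set of small measure is small, and the union of the disjoint
    intervals is such a set. [g] is cut off outside [a, b] because that continuity result concerns
    functions integrable on the whole line. *)
Lemma ac_on_integral (R : realType) (a b : R) (g : R -> R) :
  (@lebesgue_measure R).-integrable `[a, b] (EFin \o g) ->
  ac_on a b (fun t => \int[@lebesgue_measure R]_(x in `[a, t]) g x).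
Proof.
move=> intg e e0; pose mu := @lebesgue_measure R.
have intg' : mu.-integrable setT (EFin \o (g \_ `[a, b])).
  by rewrite -restrict_EFin; apply/integrable_restrict => //; rewrite setTI.
have [d [d0 Hd]] := integral_normr_continuous intg' e0.
exists d => // m I Iab tI Id.
pose F (i : 'I_m) := `](I i).1, (I i).2[%classic : set R.
have mF i : measurable (F i) by exact: measurable_itv.
have muF : mu (\big[setU/set0]_(i < m) F i) = (\sum_(i < m) ((I i).2 - (I i).1))%:E.
  transitivity (\sum_(i < m) mu (F i))%E.
    by apply: measure_semi_additive_ord => //; apply: bigsetU_measurable => i _; exact: mF.
  rewrite -sumEFin; apply: eq_bigr => i _.
  rewrite /mu lebesgue_measure_itv/= lte_fin; have [_ I12 _] := Iab i.
  case: ltP => [_|I21]; first by rewrite EFinB.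
  by rewrite (@le_anti _ _ (I i).1 (I i).2) ?subrr// I12.
have muFd : (mu (\big[setU/set0]_(i < m) F i) < d%:E)%E by rewrite muF lte_fin.
have sub i : `](I i).1, (I i).2] `<=` `[a, b].
  move=> x /=; rewrite !in_itv/= => /andP[x1 x2]; have [? ? ?] := Iab i.
  by apply/andP; split; lra.
have intF i : mu.-integrable (F i) (EFin \o (fun x => `|(g \_ `[a, b]) x|)).
  by apply: integrable_norm; apply: integrableS intg' => //; exact: mF.
apply: le_lt_trans (Hd (\big[setU/set0]_(i < m) F i) _ _); last 2 first.
- by apply: bigsetU_measurable => i _; exact: mF.
- exact: muFd.
rewrite /Rintegral integral_bigsetU_EFin//; last 3 first.
- exact: index_enum_uniq.
- by apply: sub_trivIset tI.
- apply/measurable_EFinP/measurable_funTS/measurableT_comp => //.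
  by apply/measurable_EFinP; exact: measurable_int intg'.
rewrite -sum_fine/=; last first.
  by move=> i _; apply: integrable_fin_num; [exact: mF|exact: intF].
apply: ler_sum => i _; have [aI1 I12 I2b] := Iab i.
have intab c : c <= b -> mu.-integrable `[a, c] (EFin \o g).
  by move=> cb; apply: integrableS intg => //; apply: subset_itvl; rewrite bnd_simp.
have intc : mu.-integrable `](I i).1, (I i).2] (EFin \o g) by exact: integrableS intg.
have into : mu.-integrable `](I i).1, (I i).2[ (EFin \o g).
  by apply: integrableS intc => //; apply: subset_itvl; rewrite bnd_simp.
rewrite Rintegral_itvB ?bnd_simp//; last exact: intab.
rewrite -Rintegral_itv_bndo_bndc//.
apply: le_trans (le_normr_Rintegral _ into) _ => //.
rewrite le_eqVlt; apply/orP; left; apply/eqP.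
apply: eq_Rintegral => x; rewrite inE/= => xI.
rewrite patchE mem_set//=; apply: (sub i).
by move: xI; rewrite /= !in_itv/= => /andP[-> /ltW].
Qed.

Lemma ae_neq (R : realType) (a : R) : {ae @lebesgue_measure R, forall t, t != a}.
Proof.
exists [set a]; split; [exact: measurable_set1|exact: lebesgue_measure_set1|].
by move=> t /= /negP; rewrite negbK => /eqP.
Qed.

(** Lebesgue differentiation for [g] cut off outside [a, b]. Both end points are discarded as a null
    set, because the derivative is two-sided. *)
Lemma ae_is_derive_integral (R : realType) (a b : R) (g : R -> R) :
  (@lebesgue_measure R).-integrable `[a, b] (EFin \o g) ->
  {ae @lebesgue_measure R, forall t, a <= t <= b ->
    is_derive t 1 (fun t => \int[@lebesgue_measure R]_(x in `[a, t]) g x) (g t)}.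
Proof.
move=> intg; pose mu := @lebesgue_measure R.
have locg := integrable_locally (measurable_itv _) intg.
have := lebesgue_differentiation locg.
move=> H; have := ae_neq a; have := ae_neq b; move: H.
apply: filterS3 => t Lt tb ta /andP[at_ tb'].
have {}at_ : a < t by rewrite lt_neqAle at_ eq_sym ta.
have {}tb : t < b by rewrite lt_neqAle tb' tb.
have intg' : mu.-integrable `[a, b] (EFin \o (g \_ `[a, b])).
  by apply: eq_integrable intg => // x xab; rewrite /= patchE xab.
have [|dF F't] := FTC1_lebesgue_pt tb intg' _ Lt; first by rewrite lte_fin.
set F := (fun y => _) in dF F't.
have {F't} dF' : is_derive t 1 F (g t).
  move: F't; rewrite derive1E patchE mem_set/= => [<-|].
    exact: derivableP.
  by rewrite in_itv/= !ltW.
apply: near_eq_is_derive dF'; near=> y.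
apply: eq_Rintegral => x; rewrite inE/= in_itv/= => /andP[ax xy].
rewrite patchE mem_set//= in_itv/= ax/= (le_trans xy)// ltW//.
by near: y; exact: lt_nbhsl.
Unshelve. all: by end_near. Qed.

(** Subtracting the primitive of [g] leaves an absolutely continuous function with nonpositive
    derivative almost everywhere. A one-sided bound on the derivative is thus enough, and f' itself
    is never integrated. *)
Lemma ac_on_le_integral (R : realType) (a b : R) (f g : R -> R) :
  a <= b -> ac_on a b f ->
  (@lebesgue_measure R).-integrable `[a, b] (EFin \o g) ->
  {ae @lebesgue_measure R, forall t, a <= t <= b ->
    exists2 l, l <= g t & is_derive t 1 f l} ->
  f b - f a <= \int[@lebesgue_measure R]_(x in `[a, b]) g x.
Proof.
move=> ab acf intg aef.
pose G t := \int[@lebesgue_measure R]_(x in `[a, t]) g x.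
have acG : ac_on a b G by exact: ac_on_integral.
have ac1 : ac_on a b (fun t => f t - G t).
  apply: (@ac_on_dominated _ _ _ _ _ _ 1 _ f G) => // s t _ _ _.
  have -> : f t - G t - (f s - G s) = (f t - f s) - (G t - G s) by ring.
  by rewrite mul1r; exact: ler_normB.
have := @ac_nonincreasing _ _ _ _ ab ac1.
rewrite {4}/G set_itv1 Rintegral_set1 subr0 => H.
suff : f b - G b <= f a by rewrite lerBlDl -lerBlDr.
apply: H; move: aef (ae_is_derive_integral intg).
apply: filterS2 => t Hf HG tab; have [l lg df] := Hf tab; have {}HG := HG tab.
exists (l - g t); first by rewrite subr_le0.
exact: is_deriveB.
Qed.

(** * The matrix exponential *)

Lemma is_derive_sum_fun (R : realType) (n : nat) (h : 'I_n -> R -> R) (dh : 'I_n -> R)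
    (t : R) :
  (forall i, is_derive t 1 (h i) (dh i)) ->
  is_derive t 1 (fun s => \sum_(i < n) h i s) (\sum_(i < n) dh i).
Proof.
move=> H; have := is_derive_sum H; congr is_derive.
by apply/funext => s; rewrite fct_sumE.
Qed.

Lemma is_derive_mul (R : realType) (f g : R -> R) (df dg t : R) :
  is_derive t 1 f df -> is_derive t 1 g dg ->
  is_derive t 1 (fun s => f s * g s) (df * g t + f t * dg).
Proof.
move=> Hf Hg; have H := is_deriveM Hf Hg; apply: is_derive_eq H _.
by rewrite /GRing.scale/= addrC mulrC.
Qed.

Lemma is_derive_mx (R : realType) (m n : nat) (x : R -> 'M[R]_(m, n)) (t : R)
    (dx : 'M[R]_(m, n)) :
  is_derive t 1 x dx <-> forall i j, is_derive t 1 (fun s => x s i j) (dx i j).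
Proof.
split=> [[dx1 <-] i j|H].
  rewrite derive_mx// mxE; apply: derivableP.
  by move/derivable_mxP : dx1.
have dx1 : derivable x t 1 by apply/derivable_mxP => i j; have [] := H i j.
apply: DeriveDef => //; rewrite derive_mx//; apply/matrixP => i j; rewrite mxE.
by have [] := H i j.
Qed.

Section expmx.
Variables (R : realType) (n : nat) (A : 'M[R]_n).
Implicit Types (B : 'M[R]_n) (i j : 'I_n).

(** The left factor [B] makes the family stable under termwise differentiation, which replaces [B]
    by [B *m A]. *)
Let expc B i j : R^nat := fun k => (B *m A ^+ k) i j / k`!%:R.

Let msum B : R := \sum_i \sum_j `|B i j|.

Let msum_row B i : \sum_j `|B i j| <= msum B.
Proof. by rewrite [leRHS](bigD1 i)//= lerDl sumr_ge0// => l _; exact: sumr_ge0. Qed.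

Let msum_ge0 B : 0 <= msum B.
Proof. by apply: sumr_ge0 => i _; exact: sumr_ge0. Qed.

Let pow_bound k B i j : `|(B *m A ^+ k) i j| <= (msum B) * msum A ^+ k.
Proof.
elim: k B i j => [|k IH] B i j.
  rewrite expr0 mulmx1 expr0 mulr1 (le_trans _ (msum_row B i))//.
  by rewrite [leRHS](bigD1 j)//= lerDl sumr_ge0.
rewrite exprSr -[A ^+ k * A]/(A ^+ k *m A) mulmxA mxE (le_trans (ler_norm_sum _ _ _))//.
rewrite exprSr mulrA.
apply: (@le_trans _ _ (\sum_l msum B * msum A ^+ k * `|A l j|)).
  by apply: ler_sum => l _; rewrite normrM ler_wpM2r.
rewrite -mulr_sumr ler_wpM2l ?mulr_ge0 ?exprn_ge0//.
by apply: ler_sum => l _; rewrite [leRHS](bigD1 j)//= lerDl sumr_ge0.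
Qed.

(** Comparison with the scalar exponential series at [msum A] times |x|, where [msum] is the
    entrywise l1 norm. *)
Let expc_cvg B i j x : cvgn (pseries (expc B i j) x).
Proof.
apply: normed_cvg.
apply: (@series_le_cvg _ _ (msum B *: exp_coeff (msum A * `|x|))) => [k|k|k|].
- exact: normr_ge0.
- by rewrite fctE/= mulr_ge0// exp_coeff_ge0// mulr_ge0.
- rewrite fctE /= /exp_coeff/= /GRing.scale/= /expc !normrM normfV normrX.
  rewrite (ger0_norm (ler0n _ _)) exprMn mulrAC !mulrA ler_wpM2r ?invr_ge0//.
  by rewrite ler_wpM2r ?exprn_ge0.
- exact/is_cvg_seriesZ/is_cvg_series_exp_coeff.
Qed.

Let diffs_expc B i j : pseries_diffs (expc B i j) = expc (B *m A) i j.
Proof.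
apply/funext => k; rewrite /pseries_diffs /expc factS natrM exprS.
rewrite -[A * _]/(A *m _) mulmxA; field.
by rewrite pnatr_eq0 -lt0n fact_gt0/= addrC natr1 pnatr_eq0.
Qed.

Definition expmx (t : R) : 'M[R]_n :=
  \matrix_(i, j) limn (pseries (fun k => (A ^+ k) i j / k`!%:R) t).

Let expmxE B t i j : (B *m expmx t) i j = limn (pseries (expc B i j) t).
Proof.
rewrite mxE; apply/esym/cvg_lim => //.
have -> : pseries (expc B i j) t =
    fun k => \sum_l B i l * pseries (expc 1%:M l j) t k.
  apply/funext => k; rewrite /pseries /series/=.
  under [RHS]eq_bigr do rewrite mulr_sumr.
  rewrite exchange_big/=; apply: eq_bigr => m _.
  rewrite /expc mxE mulr_suml mulr_suml; apply: eq_bigr => l _.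
  by rewrite mul1mx !mulrA.
apply: cvg_big => [|l _]; first by exact: add_continuous.
apply: cvgM; first exact: cvg_cst.
rewrite mxE; have := @expc_cvg 1%:M l j t.
rewrite (_ : expc 1%:M l j = (fun k => (A ^+ k) l j / k`!%:R)) => [//|].
by apply/funext => k; rewrite /expc mul1mx.
Qed.

Lemma is_derive_expmx t i j :
  is_derive (t : R) 1 (fun s : R => expmx s i j) ((A *m expmx t) i j).
Proof.
(* Termwise differentiation asks for convergence of the series and of its first two formal
   derivatives at a point beyond |t|. *)
have := @pseries_snd_diffs R (expc 1%:M i j) (`|t| + 1) t.
rewrite !diffs_expc mul1mx expmxE => H.
have -> : (fun s => expmx s i j) = (fun s => limn (pseries (expc 1%:M i j) s)).
  by apply/funext => s; rewrite -expmxE mul1mx.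
apply: H; [exact: expc_cvg|exact: expc_cvg|exact: expc_cvg|].
by rewrite [ltRHS]ger0_norm ?ltrDl// addr_ge0.
Qed.

Lemma expmx_comm t : A *m expmx t = expmx t *m A.
Proof.
apply/matrixP => i j; rewrite expmxE mxE.
rewrite (_ : pseries (expc A i j) t =
    fun k => \sum_l pseries (expc 1%:M i l) t k * A l j); last first.
  apply/funext => k; rewrite /pseries /series/=.
  under [RHS]eq_bigr do rewrite mulr_suml.
  rewrite exchange_big/=; apply: eq_bigr => m _.
  rewrite /expc -[A *m _]/(A * _) -exprS exprSr mxE mulr_suml mulr_suml.
  apply: eq_bigr => l _; rewrite mul1mx; ring.
apply/cvg_lim => //; apply: cvg_big => [|l _]; first by exact: add_continuous.
apply: cvgM; last exact: cvg_cst.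
have := @expc_cvg 1%:M i l t; rewrite mxE.
rewrite (_ : expc 1%:M i l = (fun k => (A ^+ k) i l / k`!%:R)) => [//|].
by apply/funext => k; rewrite /expc mul1mx.
Qed.

Lemma expmx0 : expmx 0 = 1%:M.
Proof.
apply/matrixP => i j; rewrite mxE; apply/cvg_lim => //.
rewrite -(cvg_shiftn 1)/=.
apply: cvg_near_cst; apply: nearW => k; rewrite /pseries/series/= addn1.
rewrite big_nat_recl//= big1 => [|m _]; last by rewrite expr0n/= mulr0.
by rewrite addr0 !expr0 mulr1 fact0 divr1.
Qed.

(** The product has zero derivative, since [A] commutes with its exponential, and therefore keeps
    its value at 0. *)
Lemma expmxN t : expmx t *m expmx (- t) = 1%:M.
Proof.
apply/matrixP => i j.
pose f (s : R) := (expmx s *m expmx (- s)) i j.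
suff f' (s : R) : is_derive s 1 f 0.
  by rewrite -[LHS]/(f t) (is_derive_0_is_cst t 0 f') /f oppr0 expmx0 mulmx1.
have fE : f = (fun s => \sum_l expmx s i l * expmx (- s) l j).
  by apply/funext => u; rewrite /f mxE.
have dN l : is_derive s 1 (fun s => expmx (- s) l j) (- (A *m expmx (- s)) l j).
  have := @is_derive1_comp _ (fun u => expmx u l j) -%R s _ _
    (is_derive_expmx (- s) l j) (is_deriveNid s 1).
  by rewrite mulrN1.
rewrite fE; apply: is_derive_eq (is_derive_sum_fun
  (fun l => is_derive_mul (is_derive_expmx s i l) (dN l))) _.
rewrite big_split/=; under [X in _ + X]eq_bigr do rewrite mulrN.
rewrite sumrN; apply/eqP; rewrite subr_eq0; apply/eqP.
have -> : \sum_l expmx s i l * (A *m expmx (- s)) l j =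
    (expmx s *m (A *m expmx (- s))) i j by rewrite [RHS]mxE.
by rewrite mulmxA -expmx_comm [RHS]mxE.
Qed.

End expmx.

(** * Lyapunov functions of Hurwitz matrices *)

Section complex_parts.
Variable R : realType.
Let C := complex R.

Lemma Re_mulmx (m n p : nat) (P : 'M[C]_(m, n)) (Q : 'M[C]_(n, p)) :
  map_mx (@complex.Re R) (P *m Q) =
    map_mx (@complex.Re R) P *m map_mx (@complex.Re R) Q -
    map_mx (@complex.Im R) P *m map_mx (@complex.Im R) Q.
Proof.
apply/matrixP => i j; rewrite !mxE raddf_sum -sumrB; apply: eq_bigr => k _.
by rewrite !mxE; case: (P i k) => a b; case: (Q k j).
Qed.

Lemma Im_mulmx (m n p : nat) (P : 'M[C]_(m, n)) (Q : 'M[C]_(n, p)) :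
  map_mx (@complex.Im R) (P *m Q) =
    map_mx (@complex.Re R) P *m map_mx (@complex.Im R) Q +
    map_mx (@complex.Im R) P *m map_mx (@complex.Re R) Q.
Proof.
apply/matrixP => i j; rewrite !mxE raddf_sum -big_split; apply: eq_bigr => k _.
by rewrite !mxE; case: (P i k) => a b; case: (Q k j).
Qed.

(** The complex Schur form P A = T P with P unitary and T lower triangular, written out for P = Pr +
    i Pi and T = Tr + i Ti. The diagonal of T consists of eigenvalues of A, whence the sign of
    [Tr i i]; the first equation is the real part of P^* P = 1. *)
Lemma hurwitz_schur (n : nat) (A : 'M[R]_n) : hurwitz A ->
  exists Pr Pi Tr Ti : 'M[R]_n,
    [/\ Pr^T *m Pr + Pi^T *m Pi = 1%:M,
        Pr *m A = Tr *m Pr - Ti *m Pi, Pi *m A = Tr *m Pi + Ti *m Pr,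
        is_trig_mx Tr /\ is_trig_mx Ti & forall i, Tr i i < 0].
Proof.
case: n A => [|n] A hA.
  exists 0, 0, 0, 0; split=> [||||[]//]; try by apply/matrixP => -[].
  by split; apply/is_trig_mxP => -[].
pose Ac := map_mx (real_complex R) A.
have [P Pu PAt] := @Schur _ n.+1 Ac isT.
have Punit := unitarymx_unit Pu.
pose T := conjmx P Ac.
have tT : is_trig_mx T by exact: PAt.
have PA : P *m Ac = T *m P by rewrite /T conjumx// mulmxKV.
have RA : map_mx (@complex.Re R) Ac = A by apply/matrixP => i j; rewrite !mxE.
have IA : map_mx (@complex.Im R) Ac = 0 by apply/matrixP => i j; rewrite !mxE.
exists (map_mx (@complex.Re R) P), (map_mx (@complex.Im R) P).
exists (map_mx (@complex.Re R) T), (map_mx (@complex.Im R) T); split.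
- have := mulVmx Punit; rewrite invmx_unitary// => PP.
  apply/matrixP => i j; have /(congr1 (fun Q : 'M[C]_n.+1 => complex.Re (Q i j))) := PP.
  rewrite !mxE raddf_sum -big_split/= => H.
  transitivity (complex.Re ((i == j)%:R : C)); last by case: (i == j).
  rewrite -H; apply: eq_bigr => k _; rewrite !mxE.
  by case: (P k i) => a b; case: (P k j) => c d /=; ring.
- by rewrite -Re_mulmx -PA Re_mulmx RA IA mulmx0 subr0.
- by rewrite -Im_mulmx -PA Im_mulmx RA IA mulmx0 add0r.
- by split; apply/is_trig_mxP => i j ij; rewrite mxE (is_trig_mxP tT).
(* Eigenvectors are row vectors: if v T = l v, then v P is an eigenvector of [Ac] for l, nonzero
   because P is invertible. *)
move=> i; rewrite mxE; apply: hA; apply/eigenvalueP.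
have : eigenvalue T (T i i).
  rewrite eigenvalue_root_char char_poly_trig// rootE.
  by rewrite horner_prod (bigD1 i)//= hornerXsubC subrr mul0r.
move=> /eigenvalueP[v vT v0]; exists (v *m P).
  by rewrite -mulmxA PA mulmxA vT scalemxAl.
apply: contra_neq v0 => vP.
by rewrite -(mulmxK Punit v) vP mul0mx.
Qed.

End complex_parts.

(* With weights c i = de ^ (2 i), the entries below the diagonal are damped by
   at least one factor de, so for small de the diagonal dominates.  The pair
   (p, q) stands for the real and imaginary parts of a complex vector. *)
Lemma trig_diagonal_scaling (R : realType) (n : nat) (S W : 'M[R]_n) :
  is_trig_mx S -> is_trig_mx W -> (forall i, S i i < 0) ->
  exists c : 'I_n -> R, (forall i, 0 <= c i) /\ exists2 e, 0 < e & forall p q : 'I_n -> R,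
    \sum_i \sum_j c i * (p i * (S i j * p j - W i j * q j) +
                        q i * (S i j * q j + W i j * p j)) <=
    - e * \sum_i (p i ^+ 2 + q i ^+ 2).
Proof.
move=> tS tW S0.
pose al : R := \big[Order.min/1]_i (- S i i).
have al0 : 0 < al by apply/bigmin_gtP; split=> // i _; rewrite oppr_gt0.
have alS i : S i i <= - al by rewrite lerNr; apply: bigmin_le_cond.
pose K : R := \sum_i \sum_j (`|S i j| + `|W i j|).
have K_ge i j : `|S i j| + `|W i j| <= K.
  rewrite /K (bigD1 i)//= (bigD1 j)//= -addrA lerDl addr_ge0//.
    by apply: sumr_ge0 => l _; exact: addr_ge0.
  by apply: sumr_ge0 => l _; apply: sumr_ge0 => m _; exact: addr_ge0.
have K0 : 0 <= K by apply: sumr_ge0 => l _; apply: sumr_ge0 => m _; exact: addr_ge0.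
have Kn0 : 0 <= K * n%:R by rewrite mulr_ge0.
pose D : R := 4 * (K * n%:R) + 1; have D0 : 0 < D by rewrite ltr_wpDl// mulr_ge0.
(* The off-diagonal terms add up to at most 2 K de n times the weighted energy; this choice makes
   that factor at most al / 2, half of what the diagonal provides. *)
pose de := Num.min 1 (al / D).
have de0 : 0 < de by rewrite lt_min ltr01 divr_gt0.
have de1 : de <= 1 by rewrite ge_min lexx.
have deK : 2 * K * de * n%:R <= al / 2.
  have : de <= al / D by rewrite ge_min lexx orbT.
  rewrite ler_pdivlMr// /D => h.
  have : 0 <= de by exact: ltW.
  have -> : 2 * K * de * n%:R = 2 * de * (K * n%:R) by ring.
  by move: h; set z := K * n%:R; lra.
exists (fun i => de ^+ i ^+ 2); split=> [i|]; first exact: sqr_ge0.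
(* The other half of the diagonal decay survives, and de ^ (2 n) bounds every weight de ^ (2 i) from
   below because de <= 1. *)
exists (al / 2 * de ^+ n ^+ 2) => [|p q].
  by rewrite mulr_gt0 ?divr_gt0// exprn_gt0// exprn_gt0.
pose en i : R := de ^+ (i : 'I_n) ^+ 2 * (p i ^+ 2 + q i ^+ 2).
pose s i : R := de ^+ (i : 'I_n) * (`|p i| + `|q i|).
have en0 i : 0 <= en i by rewrite mulr_ge0 ?sqr_ge0// addr_ge0 ?sqr_ge0.
have sen i : s i ^+ 2 <= 2 * en i.
  rewrite /s /en exprMn [leRHS]mulrCA ler_wpM2l ?sqr_ge0//.
  rewrite -(real_normK (num_real (p i))) -(real_normK (num_real (q i))).
  by have := sqr_ge0 (`|p i| - `|q i|); nra.
have term (i j : 'I_n) : de ^+ i ^+ 2 * (p i * (S i j * p j - W i j * q j) +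
      q i * (S i j * q j + W i j * p j)) <=
    (if j == i then - al * en i else 0) + K * de / 2 * (s i ^+ 2 + s j ^+ 2).
  have rest0 : 0 <= K * de / 2 * (s i ^+ 2 + s j ^+ 2).
    by rewrite mulr_ge0 ?addr_ge0 ?sqr_ge0// divr_ge0// mulr_ge0// ltW.
  have [ij|ji|/val_inj ij] := ltngtP i j.
  - rewrite (is_trig_mxP tS)// (is_trig_mxP tW)// !mul0r subrr addr0 !mulr0 addr0 mulr0.
    by rewrite ifN ?add0r// -val_eqE/= gtn_eqF.
  - rewrite ifN; last by rewrite -val_eqE/= ltn_eqF.
    rewrite add0r.
    apply: (@le_trans _ _ (de ^+ i ^+ 2 * (K * ((`|p i| + `|q i|) * (`|p j| + `|q j|))))).
      rewrite ler_wpM2l ?sqr_ge0//.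
      apply: (@le_trans _ _ ((`|S i j| + `|W i j|) * ((`|p i| + `|q i|) * (`|p j| + `|q j|)))); last first.
        by rewrite ler_wpM2r// mulr_ge0// addr_ge0.
      have H (a b c : R) : a * b * c <= `|a| * `|b| * `|c| by rewrite -!normrM ler_norm.
      have H' (a b c : R) : - (a * b * c) <= `|a| * `|b| * `|c|.
        by rewrite -!normrM -normrN ler_norm.
      have := H (S i j) (p i) (p j); have := H (S i j) (q i) (q j).
      have := H (W i j) (q i) (p j); have := H' (W i j) (p i) (q j).
      have : 0 <= `|S i j| * `|p i| * `|q j| by rewrite !mulr_ge0.
      have : 0 <= `|S i j| * `|q i| * `|p j| by rewrite !mulr_ge0.
      have : 0 <= `|W i j| * `|p i| * `|p j| by rewrite !mulr_ge0.
      have : 0 <= `|W i j| * `|q i| * `|q j| by rewrite !mulr_ge0.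
      by lra.
    (* The weight de ^ (2 i) splits into de ^ i and de ^ j, absorbed by [s i] and [s j], and a spare
       factor de ^ (i - j), which is at most de because j < i. *)
    have -> : de ^+ i ^+ 2 * (K * ((`|p i| + `|q i|) * (`|p j| + `|q j|))) =
        K * de ^+ (i - j) * (s i * s j).
      rewrite /s -{1 3}(subnK (ltnW ji)) exprD; ring.
    apply: (@le_trans _ _ (K * de * (s i * s j))).
      apply: ler_wpM2r; first by rewrite !mulr_ge0 ?addr_ge0 ?exprn_ge0// ltW.
      rewrite ler_wpM2l// -(subnKC ji) addSnnS addnC addnK exprS ler_piMr//.
        exact: ltW.
      by rewrite exprn_ile1// ltW.
    have : 0 <= K * de by rewrite mulr_ge0// ltW.
    by have := sqr_ge0 (s i - s j); set z := K * de; nra.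
  - rewrite ij eqxx; apply: (@le_trans _ _ (- al * en j)); last first.
      by rewrite lerDl; move: rest0; rewrite ij.
    rewrite /en.
    have -> : de ^+ j ^+ 2 * (p j * (S j j * p j - W j j * q j) +
       q j * (S j j * q j + W j j * p j)) = S j j * (de ^+ j ^+ 2 * (p j ^+ 2 + q j ^+ 2)) by ring.
    by rewrite ler_wpM2r// -/(en j).
apply: (@le_trans _ _ (\sum_i \sum_j
   ((if j == i then - al * en i else 0) + K * de / 2 * (s i ^+ 2 + s j ^+ 2)))).
  by apply: ler_sum => i _; apply: ler_sum => j _; exact: term.
have sum1 : \sum_i \sum_j (if j == i then - al * en i else 0) = - al * \sum_i en i.
  rewrite mulr_sumr; apply: eq_bigr => i _.
  by rewrite -big_mkcond/= big_pred1_eq.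
have sum2 : \sum_i \sum_j (K * de / 2 * (s i ^+ 2 + s j ^+ 2)) =
    K * de * n%:R * \sum_i s i ^+ 2.
  under eq_bigr do rewrite -mulr_sumr.
  rewrite -mulr_sumr; under eq_bigr do rewrite big_split/= sumr_const card_ord.
  rewrite big_split/= sumr_const card_ord sumrMnl.
  rewrite -[X in X + _]mulr_natr -[X in _ + X]mulr_natr.
  by set Y := \sum_i s i ^+ 2; field.
under eq_bigr do rewrite big_split/=.
rewrite big_split/= sum1 sum2.
have Es : \sum_i s i ^+ 2 <= 2 * \sum_i en i by rewrite mulr_sumr; exact: ler_sum.
have Een : de ^+ n ^+ 2 * \sum_i (p i ^+ 2 + q i ^+ 2) <= \sum_i en i.
  rewrite mulr_sumr; apply: ler_sum => i _; rewrite ler_wpM2r ?addr_ge0 ?sqr_ge0//.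
  apply: lerXn2r; rewrite ?nnegrE ?exprn_ge0 ?(ltW de0)//.
  by apply: ler_wiXn2l; [exact: ltW|exact: de1|exact/ltnW].
have En0 : 0 <= \sum_i en i by exact: sumr_ge0.
have : K * de * n%:R * (\sum_i s i ^+ 2) <= al / 2 * \sum_i en i.
  apply: (@le_trans _ _ (K * de * n%:R * (2 * \sum_i en i))).
    by rewrite ler_wpM2l// !mulr_ge0// ltW.
  have -> : K * de * n%:R * (2 * \sum_i en i) = (2 * K * de * n%:R) * \sum_i en i by ring.
  by rewrite ler_wpM2r.
have : al / 2 * (de ^+ n ^+ 2 * (\sum_i (p i ^+ 2 + q i ^+ 2))) <= al / 2 * \sum_i en i.
  by rewrite ler_wpM2l// divr_ge0// ltW.
set Z := \sum_i (p i ^+ 2 + q i ^+ 2); set E := \sum_i en i.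
by set Y := \sum_i s i ^+ 2; lra.
Qed.

Lemma mul_diag_form (R : realType) (n : nat) (u v : 'cV[R]_n) (d : 'rV[R]_n) :
  (u^T *m diag_mx d *m v) 0 0 = \sum_i d 0 i * (u i 0 * v i 0).
Proof.
rewrite mxE; apply: eq_bigr => i _; rewrite mul_mx_diag !mxE; ring.
Qed.

Lemma sqnormE (R : realType) (n : nat) (x : 'cV[R]_n) : sqnorm x = \sum_i x i 0 ^+ 2.
Proof. by rewrite /sqnorm mxE; apply: eq_bigr => i _; rewrite mxE expr2. Qed.

(** [X] is the real part of P^* D P, with P the unitary matrix of the Schur form and D the diagonal
    weights, so [qform X x] is the weighted sum of |(P x)_i|^2. Since P preserves the norm, decay
    measured on P x is decay measured on x. *)
Lemma lyapunov (R : realType) (n : nat) (A : 'M[R]_n) : hurwitz A ->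
  exists X : 'M[R]_n, [/\ X^T = X, forall x, 0 <= qform X x &
    exists2 e, 0 < e & forall x : 'cV[R]_n, (x^T *m X *m (A *m x)) 0 0 <= - e * sqnorm x].
Proof.
move=> /hurwitz_schur[Pr [Pi [S [W [PP PrA PiA [tS tW] S0]]]]].
have [c [c0 [e e0 He]]] := trig_diagonal_scaling tS tW S0.
pose D := diag_mx (\row_i c i).
have XE (x y : 'cV[R]_n) : (x^T *m (Pr^T *m D *m Pr + Pi^T *m D *m Pi) *m y) 0 0 =
    \sum_i c i * ((Pr *m x) i 0 * (Pr *m y) i 0 + (Pi *m x) i 0 * (Pi *m y) i 0).
  rewrite mulmxDr mulmxDl mxE.
  have -> : x^T *m (Pr^T *m D *m Pr) *m y = (Pr *m x)^T *m D *m (Pr *m y).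
    by rewrite trmx_mul !mulmxA.
  have -> : x^T *m (Pi^T *m D *m Pi) *m y = (Pi *m x)^T *m D *m (Pi *m y).
    by rewrite trmx_mul !mulmxA.
  rewrite !mul_diag_form -big_split/=; apply: eq_bigr => i _.
  by rewrite !mxE mulrDr.
exists (Pr^T *m D *m Pr + Pi^T *m D *m Pi); split.
- by rewrite linearD/= !trmx_mul !trmxK tr_diag_mx !mulmxA.
- move=> x; rewrite /qform XE; apply: sumr_ge0 => i _.
  by rewrite mulr_ge0// -!expr2 addr_ge0 ?sqr_ge0.
exists e => // x; rewrite XE.
have -> : sqnorm x = \sum_i ((Pr *m x) i 0 ^+ 2 + (Pi *m x) i 0 ^+ 2).
  rewrite big_split/= -!sqnormE /sqnorm !trmx_mul.
  have -> : x^T *m x = x^T *m (Pr^T *m Pr + Pi^T *m Pi) *m x by rewrite PP mulmx1.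
  by rewrite mulmxDr mulmxDl mxE !mulmxA.
apply: le_trans (He (fun i => (Pr *m x) i 0) (fun i => (Pi *m x) i 0)).
rewrite le_eqVlt; apply/orP; left; apply/eqP; apply: eq_bigr => i _.
rewrite -mulr_sumr; congr (_ * _); rewrite big_split/= -!mulr_sumr.
congr (_ * _ + _ * _).
  by rewrite mulmxA PrA mulmxBl -!mulmxA !mxE -sumrB.
by rewrite mulmxA PiA mulmxDl -!mulmxA !mxE -big_split.
Qed.

(** * Absolutely continuous curves under C1 functions *)

(** Moving by less than the uniform continuity step for tolerance 1 raises a bound by at most 1. *)
Lemma ac_on_bounded (R : realType) (W : normedModType R) (a b : R) (f : R -> W) :
  ac_on a b f -> exists2 M, 0 <= M & forall t, a <= t <= b -> `|f t| <= M.
Proof.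
move=> /ac_on_unif/(_ 1 ltr01)[d d0 fd].
have [ab|ba] := leP a b; last first.
  by exists 0 => // t /andP[at_ /(le_trans at_)]; rewrite leNgt ba.
pose Q t := exists2 M, 0 <= M & forall s, a <= s <= t -> `|f s| <= M.
have extend t t' : t' <= b -> a <= t -> `|t' - t| < d -> Q t -> Q t'.
  move=> tb at_ tt' [M M0 QM]; exists (M + 1) => [|s /andP[as_ st']]; first exact: addr_ge0.
  have [st|ts] := leP s t; first by apply: (le_trans (QM s _)); rewrite ?as_// lerDl.
  have tt : t < t' by exact: lt_le_trans st'.
  have sb : a <= s <= b by rewrite as_ (le_trans st').
  have tab : a <= t <= b by rewrite at_ (le_trans (ltW tt)).
  have sd : `|s - t| < d.
    apply: le_lt_trans tt'; rewrite !gtr0_norm ?subr_gt0// lerD2r//.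
  have fst := fd _ _ tab sb sd.
  rewrite -(subrK (f t) (f s)) addrC (le_trans (ler_normD _ _))// lerD//.
    by apply: QM; rewrite at_ lexx.
  exact: ltW.
apply: (@real_induction _ a b Q); last by rewrite ab lexx.
- exists `|f a| => // s; rewrite -eq_le => /eqP <-//.
- move=> t /andP[at_ tb] Qt; exists (t + d); first by rewrite ltrDl.
  move=> s /andP[ts std] sb; apply: (extend t) => //.
    by rewrite gtr0_norm ?subr_gt0// ltrBlDl.
  by apply: Qt; rewrite at_ lexx.
- move=> t /andP[at_ tb] Qt; pose s := Num.max a (t - d / 2).
  have as_ : a <= s by rewrite le_max lexx.
  have st : s < t by rewrite gt_max at_/= ltrBlDr ltrDl divr_gt0.
  apply: (extend s) => //; last by apply: Qt; rewrite as_.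
  rewrite gtr0_norm ?subr_gt0// ltrBlDr addrC -ltrBlDr lt_max.
  by apply/orP; right; lra.
Qed.

Lemma ac_on_cst (R : realType) (W : normedModType R) (a b : R) (w : W) :
  ac_on a b (fun _ : R => w).
Proof.
move=> e e0; exists 1 => // m I _ _ _; rewrite big1// => i _.
by rewrite subrr normr0.
Qed.

Lemma ac_on_id (R : realType) (a b : R) : ac_on a b (id : R -> R).
Proof.
move=> e e0; exists e => // m I Iab _; apply: le_lt_trans.
by apply: ler_sum => i _; have [_ ? _] := Iab i; rewrite ger0_norm ?subr_ge0.
Qed.

Lemma ac_on_lip (R : realType) (W W1 : normedModType R) (a b K : R)
    (f : R -> W) (g : R -> W1) :
  ac_on a b g ->
  (forall s t, a <= s -> s <= t -> t <= b -> `|f t - f s| <= K * `|g t - g s|) ->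
  ac_on a b f.
Proof.
move=> acg H; apply: (@ac_on_dominated _ _ _ _ _ _ K _ _ _ acg (ac_on_cst a b (0 : R))).
by move=> s t as_ st tb; rewrite subrr normr0 addr0; exact: H.
Qed.

Lemma ac_onD (R : realType) (W : normedModType R) (a b : R) (f g : R -> W) :
  ac_on a b f -> ac_on a b g -> ac_on a b (fun t => f t + g t).
Proof.
move=> acf acg; apply: (@ac_on_dominated _ _ _ _ _ _ 1 _ _ _ acf acg) => s t _ _ _.
by rewrite mul1r opprD addrACA ler_normD.
Qed.

Lemma ac_on_sum (R : realType) (W : normedModType R) (a b : R) (n : nat)
    (f : 'I_n -> R -> W) :
  (forall i, ac_on a b (f i)) -> ac_on a b (fun t => \sum_i f i t).
Proof.
move=> acf; have -> : (fun t => \sum_i f i t) = \sum_i f i.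
  by apply/funext => t; rewrite fct_sumE.
elim/big_ind: _ => [|g h acg ach|i _]; first exact: ac_on_cst.
  exact: ac_onD.
exact: acf.
Qed.

Lemma ac_onM (R : realType) (a b : R) (f g : R -> R) :
  ac_on a b f -> ac_on a b g -> ac_on a b (fun t => f t * g t).
Proof.
move=> acf acg; have [M M0 fM] := ac_on_bounded acf; have [N N0 gN] := ac_on_bounded acg.
apply: (@ac_on_dominated _ _ _ _ _ _ (M + N) _ _ _ acf acg) => s t as_ st tb.
have sab : a <= s <= b by rewrite as_ (le_trans st).
have tab : a <= t <= b by rewrite tb (le_trans as_).
have -> : f t * g t - f s * g s = f t * (g t - g s) + (f t - f s) * g s by ring.
rewrite (le_trans (ler_normD _ _))// !normrM.
have : `|f t| * `|g t - g s| <= M * `|g t - g s| by rewrite ler_wpM2r// fM.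
have : `|f t - f s| * `|g s| <= `|f t - f s| * N by rewrite ler_wpM2l// gN.
have : 0 <= M * `|f t - f s| by rewrite mulr_ge0.
have : 0 <= N * `|g t - g s| by rewrite mulr_ge0.
by lra.
Qed.

Lemma ac_on_coord (R : realType) (a b : R) (m n : nat) (x : R -> 'M[R]_(m, n)) i j :
  ac_on a b x -> ac_on a b (fun t => x t i j).
Proof.
move=> acx; apply: (@ac_on_lip _ _ _ _ _ 1 _ _ acx) => s t _ _ _.
rewrite mul1r [leRHS]/Num.Def.normr/= mx_normrE.
by apply: le_trans; last exact: (le_bigmax _ _ (i, j)); rewrite !mxE.
Qed.

Lemma ac_on_mx (R : realType) (a b : R) (m n : nat) (x : R -> 'M[R]_(m, n)) :
  (forall i j, ac_on a b (fun t => x t i j)) -> ac_on a b x.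
Proof.
move=> acx.
have -> : x = fun t => \sum_i \sum_j x t i j *: delta_mx i j.
  by apply/funext => t; exact: matrix_sum_delta.
apply: ac_on_sum => i; apply: ac_on_sum => j.
apply: (@ac_on_lip _ _ _ _ _ `|delta_mx i j : 'M[R]_(m, n)| _ _ (acx i j)) => s t _ _ _.
by rewrite -scalerBl normrZ mulrC.
Qed.

Lemma ac_on_pair (R : realType) (W1 W2 : normedModType R) (a b : R)
    (f : R -> W1) (g : R -> W2) :
  ac_on a b f -> ac_on a b g -> ac_on a b (fun t => (f t, g t)).
Proof.
move=> acf acg; apply: (@ac_on_dominated _ _ _ _ _ _ 1 _ _ _ acf acg) => s t _ _ _.
by rewrite mul1r prod_normE/= ge_max lerDl lerDr !normr_ge0.
Qed.

Lemma is_derive_continuous (R : realType) (f df : R -> R) :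
  (forall t : R, is_derive t 1 f (df t)) -> continuous f.
Proof.
by move=> fdf t; apply/differentiable_continuous/derivable1_diffP; have [] := fdf t.
Qed.

Lemma ac_on_C1 (R : realType) (a b : R) (f df : R -> R) :
  (forall t : R, is_derive t 1 f (df t)) -> continuous df -> ac_on a b f.
Proof.
move=> fdf cdf; have [ab|ba] := leP a b; last first.
  apply: (@ac_on_lip _ _ _ _ _ 0 _ _ (ac_on_id a b)) => s t as_ st tb.
  by have := le_trans as_ (le_trans st tb); rewrite leNgt ba.
have cn : continuous (fun t => `|df t|).
  by move=> t; apply: continuous_comp; [exact: cdf|exact: norm_continuous].
have [c _ dfM] := EVT_max ab (continuous_subspaceT cn).
apply: (@ac_on_lip _ _ _ _ _ `|df c| _ _ (ac_on_id a b)) => s t as_ st tb.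
have [u] := MVT_segment st (fun u _ => fdf u)
  (continuous_subspaceT (is_derive_continuous fdf)).
rewrite in_itv/= => /andP[su ut] ->.
by rewrite normrM ler_wpM2r// dfM// in_itv/= (le_trans as_)// (le_trans ut).
Qed.

Lemma is_derive_diff_comp (R : realType) (U W : normedModType R) (F : U -> W)
    (q : R -> U) (t : R) (dq : U) :
  differentiable F (q t) -> is_derive t 1 q dq ->
  is_derive t 1 (fun s => F (q s)) ('d F (q t) dq).
Proof.
move=> dF [qt <-]; have dq1 : differentiable q t by exact/derivable1_diffP.
have dFq : differentiable (F \o q) t by exact: differentiable_comp.
have dd : derivable (F \o q) t 1 by exact: diff_derivable.
apply: (DeriveDef dd).
by rewrite (deriveE (1 : R) dFq) diff_comp//= (deriveE (1 : R) dq1).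
Qed.

Lemma is_derive_pair (R : realType) (U W : normedModType R) (f : R -> U)
    (g : R -> W) (t : R) (df : U) (dg : W) :
  is_derive t 1 f df -> is_derive t 1 g dg ->
  is_derive t 1 (fun s => (f s, g s)) (df, dg).
Proof.
move=> [ft <-] [gt_ <-].
have ft' : differentiable f t by exact/derivable1_diffP.
have gt' : differentiable g t by exact/derivable1_diffP.
have fg := differentiable_pair ft' gt'.
have dd : derivable (fun s => (f s, g s)) t 1 by exact: diff_derivable.
apply: (DeriveDef dd).
by rewrite (deriveE (1 : R) fg) diff_pair//= (deriveE (1 : R) ft') (deriveE (1 : R) gt').
Qed.

(* Finite dimensionality in the form used here: linear forms that depend
   continuously on a parameter in the strong topology are locally bounded in
   operator norm. *)
Definition locally_bounded_forms (R : realType) (U : normedModType R) : Prop :=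
  forall (P : topologicalType) (D : P -> U -> R) (p0 : P),
    (forall p, linear (D p)) ->
    (forall v, {for p0, continuous (fun p => D p v)}) ->
    exists2 M, 0 <= M & \forall p \near p0, forall v, `|D p v| <= M * `|v|.

Lemma locally_bounded_forms_R (R : realType) : locally_bounded_forms R.
Proof.
move=> P D p0 linD cD; exists (`|D p0 1| + 1); first exact: addr_ge0.
have := cD 1; move=> /cvgrPdist_le/(_ 1 ltr01); apply: filterS => p Dp v.
have D0 : D p 0 = 0 by have := linD p (-1) 0 0; rewrite scaler0 addr0 scaleN1r addNr.
have -> : D p v = v * D p 1.
  by have := linD p v 1 0; rewrite D0 !addr0 [_ *: 1]mulr1.
rewrite normrM mulrC ler_wpM2r//.
have := ler_normB (D p0 1) (D p0 1 - D p 1).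
by rewrite subKr => /le_trans; apply; rewrite lerD2l.
Qed.

(** A linear form is controlled by its values on the finite basis; each value at [p0] is enlarged by
    1 so as to remain a bound near [p0]. *)
Lemma locally_bounded_forms_cV (R : realType) (n : nat) :
  locally_bounded_forms 'cV[R]_n.
Proof.
move=> P D p0 linD cD; pose e i : 'cV[R]_n := delta_mx i 0.
exists (\sum_i (`|D p0 (e i)| + 1)).
  by apply: sumr_ge0 => i _; exact: addr_ge0.
have : \forall p \near p0, forall i, `|D p0 (e i) - D p (e i)| <= 1.
  by apply: filter_forall => i; have /cvgrPdist_le/(_ 1 ltr01) := cD (e i).
apply: filterS => p Dp v.
have D0 : D p 0 = 0 by have := linD p (-1) 0 0; rewrite scaler0 addr0 scaleN1r addNr.
have DD u w : D p (u + w) = D p u + D p w.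
  by have := linD p 1 u w; rewrite !scale1r.
have DZ c u : D p (c *: u) = c * D p u.
  by have := linD p c u 0; rewrite D0 !addr0.
have -> : D p v = \sum_i v i 0 * D p (e i).
  rewrite {1}(matrix_sum_delta v).
  under eq_bigr do rewrite big_ord1.
  rewrite (big_morph (D p) DD D0); apply: eq_bigr => i _.
  by rewrite DZ.
rewrite mulr_suml (le_trans (ler_norm_sum _ _ _))//; apply: ler_sum => i _.
rewrite normrM mulrC ler_pM//.
  have := ler_normB (D p0 (e i)) (D p0 (e i) - D p (e i)).
  by rewrite subKr => /le_trans; apply; rewrite lerD2l.
rewrite [leRHS]/Num.Def.normr/= mx_normrE.
exact: (le_bigmax _ (fun k => `|v k.1 k.2|) (i, 0)).
Qed.

Lemma locally_bounded_forms_pair (R : realType) (U W : normedModType R) :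
  locally_bounded_forms U -> locally_bounded_forms W ->
  locally_bounded_forms (U * W)%type.
Proof.
move=> bU bW P D p0 linD cD.
have [|v|M M0 HM] := bU P (fun p u => D p (u, 0)) p0.
- move=> p c u v; have := linD p c (u, 0) (v, 0).
  by rewrite -[c *: (u, 0)]/(c *: u, c *: 0) scaler0 -[_ + (v, 0)]/(c *: u + v, 0 + 0) addr0.
- exact: cD.
have [|v|N N0 HN] := bW P (fun p u => D p (0, u)) p0.
- move=> p c u v; have := linD p c (0, u) (0, v).
  by rewrite -[c *: (0, u)]/(c *: 0, c *: u) scaler0 -[_ + (0, v)]/(0 + 0, c *: u + v) addr0.
- exact: cD.
exists (M + N); first exact: addr_ge0.
apply: filterS2 HM HN => p HM HN [u v].
have -> : D p (u, v) = D p (u, 0) + D p (0, v).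
  have := linD p 1 (u, 0) (0, v); rewrite !scale1r => <-.
  by rewrite -[_ + (0, v)]/(u + 0, 0 + v) addr0 add0r.
rewrite (le_trans (ler_normD _ _))// mulrDl lerD//.
  by rewrite (le_trans (HM u))// ler_wpM2l// prod_normE le_max lexx.
by rewrite (le_trans (HN v))// ler_wpM2l// prod_normE le_max lexx orbT.
Qed.

Lemma is_derive_line (R : realType) (U : normedModType R) (p w : U) (s : R) :
  is_derive s 1 (fun t : R => p + t *: w) w.
Proof.
have H : h^-1 *: ((p + (h *: 1 + s) *: w) - (p + s *: w)) @[h --> (0 : R)^'] --> w.
  apply: cvg_near_cst; near=> h.
  have h0 : h != 0 by near: h; exact: nbhs_dnbhs_neq.
  rewrite opprD addrACA subrr add0r -scalerBl addrK scalerA [_ *: 1]mulr1.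
  by rewrite mulVf// scale1r.
by apply: DeriveDef; [apply/cvg_ex; exists w|exact: cvg_lim].
Unshelve. all: by end_near. Qed.

(** Mean value theorem along the segment from [p] to [q], which stays in the ball by convexity, with
    the operator bound on the differential supplied by [locally_bounded_forms]. *)
Lemma C1_locally_lipschitz (R : realType) (U : normedModType R) (F : U -> R) (p0 : U) :
  locally_bounded_forms U -> C1 F ->
  exists M, exists2 r, 0 < r & forall p q, `|p - p0| < r -> `|q - p0| < r ->
    `|F q - F p| <= M * `|q - p|.
Proof.
move=> bU [dF cF].
have [|v|M M0 HM] := bU U (fun p v => 'd F p v) p0.
- by move=> p c u v; rewrite linearP.
- exact: cF.
move/nbhs_ballP: HM => [r /= r0 HM]; exists M, r => // p q pr qr.
pose l (s : R) := p + s *: (q - p).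
have dl (s : R) : is_derive s 1 l (q - p) by exact: is_derive_line.
have dFl (s : R) : is_derive s 1 (fun s => F (l s)) ('d F (l s) (q - p)).
  exact: is_derive_diff_comp.
have cFl : continuous (fun s => F (l s)).
  by move=> u; apply/differentiable_continuous/derivable1_diffP; have [] := dFl u.
have [c] := MVT_segment ler01 (fun u _ => dFl u) (continuous_subspaceT cFl).
rewrite /l scale0r addr0 scale1r [p + (q - p)]addrC subrK subr0 mulr1 in_itv/= => /andP[c0 c1] ->.
apply: HM; rewrite -ball_normE /= distrC.
have -> : p + c *: (q - p) - p0 = (1 - c) *: (p - p0) + c *: (q - p0).
  rewrite scalerBl scale1r -[RHS]addrA (addrC (- (c *: _))) -scalerBr opprB.
  by rewrite (addrA (q - p0)) subrK addrAC.
rewrite (le_lt_trans (ler_normD _ _))// !normrZ (ger0_norm c0) ger0_norm ?subr_ge0//.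
have : (1 - c) * `|p - p0| <= (1 - c) * Num.max `|p - p0| `|q - p0|.
  by rewrite ler_wpM2l ?subr_ge0// le_max lexx.
have : c * `|q - p0| <= c * Num.max `|p - p0| `|q - p0|.
  by rewrite ler_wpM2l// le_max lexx orbT.
have : Num.max `|p - p0| `|q - p0| < r by rewrite gt_max pr.
by lra.
Qed.

Lemma Rintegral_itv_split (R : realType) (a b c : R) (g : R -> R) :
  (@lebesgue_measure R).-integrable `[a, c] (EFin \o g) -> a <= b -> b <= c ->
  \int[@lebesgue_measure R]_(x in `[a, c]) g x =
  \int[@lebesgue_measure R]_(x in `[a, b]) g x +
  \int[@lebesgue_measure R]_(x in `[b, c]) g x.
Proof.
move=> ig ab bc; apply/eqP; rewrite addrC -subr_eq; apply/eqP.
rewrite Rintegral_itvB ?bnd_simp// Rintegral_itv_obnd_cbnd//.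
by apply: integrableS ig => //; apply: subset_itv; rewrite bnd_simp.
Qed.

(** [F] is Lipschitz only near each point of the curve, so F o q is seen to be absolutely continuous
    on short intervals only; real induction glues the resulting estimates. *)
Lemma C1_le_integral (R : realType) (U : normedModType R) (F : U -> R) (q : R -> U)
    (a b : R) (g : R -> R) :
  locally_bounded_forms U -> C1 F -> a <= b -> ac_on a b q ->
  (@lebesgue_measure R).-integrable `[a, b] (EFin \o g) ->
  {ae @lebesgue_measure R, forall t, a <= t <= b ->
    exists2 dq, is_derive t 1 q dq & 'd F (q t) dq <= g t} ->
  F (q b) - F (q a) <= \int[@lebesgue_measure R]_(x in `[a, b]) g x.
Proof.
move=> bU C1F ab acq ig aeq.
pose Q t := F (q t) - F (q a) <= \int[@lebesgue_measure R]_(x in `[a, t]) g x.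
have local t : a <= t <= b -> exists2 n, 0 < n & forall s s', a <= s -> s <= s' ->
    s' <= b -> `|s - t| < n -> `|s' - t| < n -> Q s -> Q s'.
  move=> tab; have [M [r r0 HM]] := C1_locally_lipschitz (q t) bU C1F.
  have [n n0 Hn] := ac_on_unif acq r0.
  exists n => // s s' as_ ss' s'b sn s'n Qs.
  have as' : a <= s' by exact: le_trans ss'.
  have sb : s <= b by exact: le_trans s'b.
  have ig' c d : a <= c -> d <= b ->
      (@lebesgue_measure R).-integrable `[c, d] (EFin \o g).
    by move=> ac db; apply: integrableS ig => //; apply: subset_itv; rewrite bnd_simp.
  have acFq : ac_on s s' (fun u => F (q u)).
    apply: (@ac_on_lip _ _ _ _ _ M _ _ (ac_on_sub as_ s'b acq)) => u v su uv vs'.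
    have near w : s <= w -> w <= s' -> `|q w - q t| < r.
      move=> sw ws'; apply: Hn => //; first by rewrite (le_trans as_)// (le_trans ws').
      move: sn s'n; rewrite !ltr_norml => /andP[? ?] /andP[? ?].
      by apply/andP; split; lra.
    by apply: HM; apply: near => //; [exact: le_trans vs'|exact: le_trans uv].
  have := @ac_on_le_integral _ _ _ (fun u => F (q u)) g ss' acFq (ig' _ _ as_ s'b).
  move=> H; have {}H := H _; rewrite /Q (Rintegral_itv_split (ig' _ _ (lexx a) s'b) as_ ss').
  have -> : F (q s') - F (q a) = (F (q s) - F (q a)) + (F (q s') - F (q s)) by ring.
  apply: lerD => //; apply: H; apply: filterS aeq => u Hu /andP[su us'].
  have [|dq dqu le] := Hu; first by rewrite (le_trans as_)// (le_trans us').
  by exists ('d F (q u) dq) => //; apply: is_derive_diff_comp => //; case: C1F.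
suff : Q b by [].
apply: (@real_induction _ a b Q); last by rewrite ab lexx.
- by rewrite /Q subrr set_itv1 Rintegral_set1.
- move=> t /andP[at_ tb] Qt; have [|n n0 Hn] := local t; first by rewrite at_ ltW.
  exists (t + n); first by rewrite ltrDl.
  move=> s /andP[ts stn] sb; apply: (Hn t s) => //; first exact: ltW.
  + by rewrite subrr normr0.
  + by rewrite gtr0_norm ?subr_gt0// ltrBlDl.
  + by apply: Qt; rewrite at_ lexx.
- move=> t /andP[at_ tb] Qt; have [|n n0 Hn] := local t; first by rewrite ltW.
  pose s := Num.max a (t - n / 2).
  have as_ : a <= s by rewrite le_max lexx.
  have st : s < t by rewrite gt_max at_/= ltrBlDr ltrDl divr_gt0.
  apply: (Hn s t) => //; first exact: ltW.
  + rewrite ltr0_norm ?subr_lt0// opprB ltrBlDr addrC -ltrBlDr lt_max.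
    by apply/orP; right; lra.
  + by rewrite subrr normr0.
  + by apply: Qt; rewrite as_.
Qed.

(** * Square integrable signals *)

Lemma ac_on_measurable (R : realType) (a b : R) (f : R -> R) :
  ac_on a b f -> measurable_fun `[a, b] f.
Proof.
move=> /ac_on_unif acf; apply: subspace_continuous_measurable_fun => //.
apply/subspace_continuousP => t /=; rewrite in_itv/= => tab.
apply/cvgrPdist_lt => e e0; have [d d0 Hd] := acf _ e0.
rewrite near_withinE; apply/nbhs_ballP; exists d => // s; rewrite -ball_normE/=.
by move=> ts; rewrite in_itv/= => sab; exact: Hd.
Qed.

Lemma half_line_bigcup (R : realType) :
  (half_line : set R) = \bigcup_n `[0, n.+1%:R : R]%classic.
Proof.
apply/seteqP; split=> t /=; rewrite /half_line/= in_itv/= ?andbT.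
  move=> t0; exists (Num.truncn t) => //=; rewrite in_itv/= t0/=.
  by apply/ltW; rewrite truncnS_gt.
by move=> [n _ /=]; rewrite in_itv/= => /andP[].
Qed.

Lemma measurable_half_line (R : realType) (f : R -> R) :
  (forall T : R, 0 < T -> measurable_fun `[0, T] f) -> measurable_fun half_line f.
Proof.
move=> mf; rewrite half_line_bigcup.
by apply/measurable_fun_bigcup => n //; apply: mf; rewrite ltr0n.
Qed.

Section sq_integrable.
Variables (R : realType) (D : set (measurableTypeR R)).
Hypothesis mD : measurable D.
Notation mu := (@lebesgue_measure R).

(** Measurability of f is a separate clause because it does not follow from that of f^2. *)
Definition sq_integrable (f : R -> R) : Prop :=
  measurable_fun D f /\ mu.-integrable D (EFin \o (fun t => f t ^+ 2)).

Lemma sq_integrable_cst0 : sq_integrable (fun=> 0).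
Proof.
split; first exact: measurable_cst.
by rewrite (_ : _ \o _ = cst 0%E); [exact: integrable0|apply/funext => t /=; rewrite expr0n].
Qed.

Lemma sq_integrableM (f g : R -> R) : sq_integrable f -> sq_integrable g ->
  mu.-integrable D (EFin \o (fun t => f t * g t)).
Proof.
move=> [mf if2] [mg ig2].
have H := integrableD mD if2 ig2; apply: le_integrable H => //.
  by apply/measurable_EFinP; exact: measurable_funM.
move=> t _ /=; rewrite lee_fin normrM.
rewrite [leRHS]ger0_norm ?addr_ge0 ?sqr_ge0//.
rewrite -(real_normK (num_real (f t))) -(real_normK (num_real (g t))).
have := sqr_ge0 (`|f t| - `|g t|); have := normr_ge0 (f t); have := normr_ge0 (g t).
by nra.
Qed.

Lemma sq_integrableD (f g : R -> R) : sq_integrable f -> sq_integrable g ->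
  sq_integrable (fun t => f t + g t).
Proof.
move=> sf sg; have ifg := sq_integrableM sf sg; move: sf sg => [mf if2] [mg ig2].
split; first exact: measurable_funD.
have H := integrableD mD (integrableD mD if2 ig2) (integrableD mD ifg ifg).
by apply: eq_integrable H => // t _ /=; congr EFin; ring.
Qed.

Lemma sq_integrableZ (c : R) (f : R -> R) : sq_integrable f ->
  sq_integrable (fun t => c * f t).
Proof.
move=> [mf if2]; split; first exact: measurable_funM.
have H := integrableZl mD (c ^+ 2) if2.
by apply: eq_integrable H => // t _ /=; congr EFin; ring.
Qed.

Lemma sq_integrable_sum (n : nat) (f : 'I_n -> R -> R) :
  (forall i, sq_integrable (f i)) -> sq_integrable (fun t => \sum_i f i t).
Proof.
move=> sf; have -> : (fun t => \sum_i f i t) = \sum_i f i.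
  by apply/funext => t; rewrite fct_sumE.
elim/big_ind: _ => [|g h sg sh|i _]; [exact: sq_integrable_cst0| |exact: sf].
exact: sq_integrableD.
Qed.

Lemma integrable_sum_fun (n : nat) (f : 'I_n -> R -> R) :
  (forall i, mu.-integrable D (EFin \o f i)) ->
  mu.-integrable D (EFin \o (fun t => \sum_i f i t)).
Proof.
move=> sf; have H := integrable_sum mD (index_enum 'I_n) (P := xpredT) (fun i _ => sf i).
by apply: eq_integrable H => // t _ /=; rewrite sumEFin.
Qed.

Lemma integrable_scale (c : R) (f : R -> R) : mu.-integrable D (EFin \o f) ->
  mu.-integrable D (EFin \o (fun t => c * f t)).
Proof. by move=> /(integrableZl mD c); exact: eq_integrable. Qed.

Lemma integrable_sub (f g : R -> R) :
  mu.-integrable D (EFin \o f) -> mu.-integrable D (EFin \o g) ->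
  mu.-integrable D (EFin \o (fun t => f t - g t)).
Proof. by move=> ifD igD; have := integrableB mD ifD igD; exact: eq_integrable. Qed.

Definition sq_integrable_cV (n : nat) (r : R -> 'cV[R]_n) : Prop :=
  forall i, sq_integrable (fun t => r t i 0).

Lemma sq_integrable_cVD (n : nat) (r s : R -> 'cV[R]_n) :
  sq_integrable_cV r -> sq_integrable_cV s -> sq_integrable_cV (fun t => r t + s t).
Proof.
move=> sr ss i; have := sq_integrableD (sr i) (ss i).
by congr sq_integrable; apply/funext => t; rewrite mxE.
Qed.

Lemma sq_integrable_mulmx (m n : nat) (B : 'M[R]_(m, n)) (r : R -> 'cV[R]_n) :
  sq_integrable_cV r -> sq_integrable_cV (fun t => B *m r t).
Proof.
move=> sr i; have := sq_integrable_sum (fun j => sq_integrableZ (B i j) (sr j)).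
by congr sq_integrable; apply/funext => t; rewrite mxE.
Qed.

Lemma integrable_dot (n : nat) (r s : R -> 'cV[R]_n) :
  sq_integrable_cV r -> sq_integrable_cV s ->
  mu.-integrable D (EFin \o (fun t => ((r t)^T *m s t) 0 0)).
Proof.
move=> sr ss; have H := integrable_sum_fun (fun i => sq_integrableM (sr i) (ss i)).
apply: eq_integrable H => // t _ /=; rewrite mxE; congr EFin.
by apply: eq_bigr => i _; rewrite mxE.
Qed.

Lemma integrable_sqnorm (n : nat) (r : R -> 'cV[R]_n) :
  sq_integrable_cV r -> mu.-integrable D (EFin \o (fun t => sqnorm (r t))).
Proof. by move=> sr; exact: integrable_dot. Qed.

Lemma integrable_qform (n : nat) (M : 'M[R]_n) (r : R -> 'cV[R]_n) :
  sq_integrable_cV r -> mu.-integrable D (EFin \o (fun t => qform M (r t))).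
Proof.
move=> sr; have H := integrable_dot sr (sq_integrable_mulmx M sr).
by apply: eq_integrable H => // t _ /=; rewrite /qform mulmxA.
Qed.

Lemma sqnorm_ge0 (n : nat) (x : 'cV[R]_n) : 0 <= sqnorm x.
Proof. by rewrite sqnormE; apply: sumr_ge0 => i _; exact: sqr_ge0. Qed.

Lemma sqnorm_ge_coord (n : nat) (x : 'cV[R]_n) i : x i 0 ^+ 2 <= sqnorm x.
Proof.
rewrite sqnormE (bigD1 i)//= lerDl.
by apply: sumr_ge0 => j _; exact: sqr_ge0.
Qed.

Lemma measurable_sqnorm (n : nat) (r : R -> 'cV[R]_n) :
  (forall i, measurable_fun D (fun t => r t i 0)) ->
  measurable_fun D (fun t => sqnorm (r t)).
Proof.
move=> mr; under eq_fun do rewrite sqnormE.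
by apply: measurable_sum => i; apply: measurable_funX; exact: mr.
Qed.

Lemma sqnorm_integrable_sq (n : nat) (r : R -> 'cV[R]_n) :
  (forall i, measurable_fun D (fun t => r t i 0)) ->
  (\int[mu]_(t in D) (sqnorm (r t))%:E < +oo)%E -> sq_integrable_cV r.
Proof.
move=> mr rfin i; split=> //.
have ms := measurable_sqnorm mr.
have ir : mu.-integrable D (EFin \o (fun t => sqnorm (r t))).
  apply/integrableP; split; first exact/measurable_EFinP.
  by under eq_integral do rewrite /= ger0_norm ?sqnorm_ge0//.
apply: le_integrable ir => //; first exact/measurable_EFinP/measurable_funX.
by move=> t _ /=; rewrite lee_fin !ger0_norm ?sqnorm_ge0 ?sqr_ge0// sqnorm_ge_coord.
Qed.

Lemma L2_sq_integrable (n : nat) (r : R -> 'cV[R]_n) : L2 D r -> sq_integrable_cV r.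
Proof.
move=> [mr]; rewrite /L2norm => nr; apply: sqnorm_integrable_sq => //.
by move: nr; case: (\int[_]_(t in D) _)%E => [x|/=|//]; rewrite ?ltry.
Qed.

Lemma sq_integrable_bounded (f : R -> R) (C : R) : (mu D < +oo)%E ->
  measurable_fun D f -> (forall t, D t -> `|f t| <= C) -> sq_integrable f.
Proof.
move=> muD mf fC; split=> //; apply: measurable_bounded_integrable => //.
  exact: measurable_funX.
exists (C ^+ 2); split; first exact: num_real.
move=> x Cx t Dt /=; rewrite normrX (le_trans _ (ltW Cx))//.
have C0 : 0 <= C by apply: le_trans (fC t Dt).
by rewrite lerXn2r ?nnegrE// fC.
Qed.

Lemma sq_integrable_integrable (f : R -> R) : (mu D < +oo)%E ->
  sq_integrable f -> mu.-integrable D (EFin \o f).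
Proof.
move=> muD sf; have s1 : sq_integrable (fun=> 1).
  by apply: (@sq_integrable_bounded _ 1) => // t _; rewrite normr1.
by apply: eq_integrable (sq_integrableM sf s1) => // t _ /=; rewrite mulr1.
Qed.

End sq_integrable.

Lemma sq_integrableS (R : realType) (D E : set R) (n : nat) (r : R -> 'cV[R]_n) :
  measurable D -> measurable E -> D `<=` E ->
  sq_integrable_cV E r -> sq_integrable_cV D r.
Proof.
move=> mD mE DE sr i; have [mr ir] := sr i; split; first exact: measurable_funS mr.
exact: integrableS ir.
Qed.

Lemma lebesgue_itvcc_fin (R : realType) (a b : R) :
  (@lebesgue_measure R `[a, b] < +oo)%E.
Proof. by rewrite lebesgue_measure_itv; case: ifP => _; rewrite -?EFinD ltry. Qed.

Lemma ac_on_sq_integrable (R : realType) (a b : R) (n : nat) (x : R -> 'cV[R]_n) :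
  ac_on a b x -> sq_integrable_cV `[a, b] x.
Proof.
move=> acx i; have aci := @ac_on_coord _ _ _ _ _ _ i 0 acx.
have [C _ xC] := ac_on_bounded aci.
apply: (@sq_integrable_bounded _ _ _ _ C) => //; first exact: lebesgue_itvcc_fin.
exact: ac_on_measurable.
Qed.

Lemma qform_mx (R : realType) (n : nat) (X : 'M[R]_n) (x : 'cV[R]_n) :
  qform X x = \sum_i \sum_j x i 0 * X i j * x j 0.
Proof.
rewrite /qform mxE exchange_big/=; apply: eq_bigr => j _.
by rewrite mxE mulr_suml; apply: eq_bigr => i _; rewrite mxE.
Qed.

Lemma ac_on_qform (R : realType) (a b : R) (n : nat) (X : 'M[R]_n) (x : R -> 'cV[R]_n) :
  ac_on a b x -> ac_on a b (fun t => qform X (x t)).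
Proof.
move=> acx; have -> : (fun t => qform X (x t)) =
    fun t => \sum_i \sum_j (x t i 0 * X i j * x t j 0).
  by apply/funext => t; exact: qform_mx.
apply: ac_on_sum => i; apply: ac_on_sum => j.
apply: ac_onM; last exact: ac_on_coord.
by apply: ac_onM; [exact: ac_on_coord|exact: ac_on_cst].
Qed.

Lemma is_derive_qform (R : realType) (n : nat) (X : 'M[R]_n) (x : R -> 'cV[R]_n)
    (t : R) (dx : 'cV[R]_n) :
  X^T = X -> is_derive t 1 x dx ->
  is_derive t 1 (fun s => qform X (x s)) (2 * ((x t)^T *m X *m dx) 0 0).
Proof.
move=> XT /is_derive_mx dx1; have -> : (fun s => qform X (x s)) =
    fun s => \sum_i \sum_j (x s i 0 * (X i j * x s j 0)).
  apply/funext => s; rewrite qform_mx; apply: eq_bigr => i _.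
  by apply: eq_bigr => j _; rewrite mulrA.
have dXx i j : is_derive t 1 (fun s => X i j * x s j 0) (X i j * dx j 0).
  exact: is_deriveZ (dx1 j 0).
apply: is_derive_eq (is_derive_sum_fun (fun i => is_derive_sum_fun (fun j =>
  is_derive_mul (dx1 i 0) (dXx i j)))) _.
have E : ((x t)^T *m X *m dx) 0 0 = \sum_i \sum_j x t i 0 * (X i j * dx j 0).
  rewrite mxE exchange_big/=; apply: eq_bigr => j _.
  by rewrite mxE mulr_suml; apply: eq_bigr => i _; rewrite mxE mulrA.
under eq_bigr do rewrite big_split/=.
rewrite big_split/= -E exchange_big/=.
have -> : \sum_j \sum_i dx i 0 * (X i j * x t j 0) = ((x t)^T *m X *m dx) 0 0.
  rewrite E; apply: eq_bigr => i _; apply: eq_bigr => j _.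
  by rewrite -[in LHS]XT mxE; ring.
by ring.
Qed.

(** * Filter responses *)

Section response.
Variables (R : realType) (n : nat) (A : 'M[R]_n).
Notation mu := (@lebesgue_measure R).

(** Variation of constants with zero initial state. The factor exp(tA) stands outside the integral,
    so that the product rule applies and no parameter remains under the integral sign. *)
Definition lti_response (r : R -> 'cV[R]_n) (t : R) : 'cV[R]_n :=
  expmx A t *m \col_i \int[mu]_(s in `[0, t]) (expmx A (- s) *m r s) i 0.

Lemma lti_response0 (r : R -> 'cV[R]_n) : lti_response r 0 = 0.
Proof.
rewrite /lti_response expmx0 mul1mx; apply/matrixP => i j.
by rewrite !mxE set_itv1 Rintegral_set1.
Qed.

Lemma continuous_mul_expmx i j : continuous (fun t => (A *m expmx A t) i j).
Proof.
move=> t; under eq_fun do rewrite mxE.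
apply: (@is_derive_continuous _ _ (fun t => \sum_k A i k * (A *m expmx A t) k j)) => s.
by apply: is_derive_sum_fun => k; exact: is_deriveZ (is_derive_expmx A s k j).
Qed.

Lemma ac_on_expmx (a b : R) i j : ac_on a b (fun t => expmx A t i j).
Proof.
apply: (@ac_on_C1 _ _ _ _ (fun t => (A *m expmx A t) i j)).
  by move=> t; exact: is_derive_expmx.
exact: continuous_mul_expmx.
Qed.

Let kernel_integrable (r : R -> 'cV[R]_n) (T : R) i :
  sq_integrable_cV `[0, T] r ->
  mu.-integrable `[0, T] (EFin \o (fun s => (expmx A (- s) *m r s) i 0)).
Proof.
move=> sr.
have H := @integrable_sum_fun _ `[0, T]%classic (measurable_itv _) n
  (fun j s => expmx A (- s) i j * r s j 0).
rewrite (_ : (fun s => _) = fun s => \sum_j expmx A (- s) i j * r s j 0); last first.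
  by apply/funext => s; rewrite mxE.
apply: H => j; apply: sq_integrableM => //.
have acE : ac_on 0 T (fun s => expmx A (- s) i j).
  apply: (@ac_on_C1 _ _ _ _ (fun s => - (A *m expmx A (- s)) i j)) => s.
    have := @is_derive1_comp _ (fun u => expmx A u i j) -%R s _ _
      (is_derive_expmx A (- s) i j) (is_deriveNid s 1).
    by rewrite mulrN1.
  apply: continuousN.
  apply: (@continuous_comp _ _ _ -%R (fun u => (A *m expmx A u) i j)).
    exact: opp_continuous.
  exact: continuous_mul_expmx.
have [C _ EC] := ac_on_bounded acE.
apply: (@sq_integrable_bounded _ _ _ _ C) => //; first exact: lebesgue_itvcc_fin.
exact: ac_on_measurable.
Qed.

(** Causality of the filter. The responses agree at every t, not just almost every t, since the
    input enters through integrals only. *)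
Lemma eq_lti_response (r r' : R -> 'cV[R]_n) (T t : R) :
  t <= T -> sq_integrable_cV `[0, T] r -> sq_integrable_cV `[0, T] r' ->
  {ae mu, forall s, 0 <= s <= T -> r s = r' s} ->
  lti_response r t = lti_response r' t.
Proof.
move=> tT sr sr' rr'; congr (_ *m _); apply/matrixP => i j; rewrite !mxE.
have sub : `[0, t]%classic `<=` `[0, T]%classic.
  by apply: subset_itvl; rewrite bnd_simp.
have ir := @kernel_integrable r t i (sq_integrableS (measurable_itv _) (measurable_itv _) sub sr).
have ir' := @kernel_integrable r' t i (sq_integrableS (measurable_itv _) (measurable_itv _) sub sr').
congr fine; apply: ae_eq_integral => //.
- exact: measurable_int ir.
- exact: measurable_int ir'.
apply: filterS rr' => s H /sub /=; rewrite in_itv/= => /H rs.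
by rewrite rs.
Qed.

Lemma lti_response_ac (r : R -> 'cV[R]_n) (T : R) :
  sq_integrable_cV `[0, T] r -> ac_on 0 T (lti_response r).
Proof.
move=> sr; apply: ac_on_mx => i j.
rewrite (_ : (fun t => _) = fun t => \sum_k expmx A t i k *
    \int[mu]_(s in `[0, t]) (expmx A (- s) *m r s) k 0); last first.
  by apply/funext => t; rewrite /lti_response mxE; apply: eq_bigr => k _; rewrite [X in _ * X]mxE.
apply: ac_on_sum => k; apply: ac_onM; first exact: ac_on_expmx.
by apply: ac_on_integral; exact: kernel_integrable.
Qed.

Lemma lti_response_derive (r : R -> 'cV[R]_n) (T : R) :
  sq_integrable_cV `[0, T] r ->
  {ae mu, forall t, 0 <= t <= T ->
    is_derive t 1 (lti_response r) (A *m lti_response r t + r t)}.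
Proof.
move=> sr.
have : {ae mu, forall t, forall k, 0 <= t <= T ->
    is_derive t 1 (fun t => \int[mu]_(s in `[0, t]) (expmx A (- s) *m r s) k 0)
      ((expmx A (- t) *m r t) k 0)}.
  apply: filter_forall => k; apply: ae_is_derive_integral.
  exact: kernel_integrable.
apply: filterS => t H tT; apply/is_derive_mx => i j; rewrite ord1.
have -> : (fun t => lti_response r t i 0) = fun t => \sum_k expmx A t i k *
    \int[mu]_(s in `[0, t]) (expmx A (- s) *m r s) k 0.
  by apply/funext => u; rewrite /lti_response mxE; apply: eq_bigr => k _; rewrite [X in _ * X]mxE.
apply: is_derive_eq (is_derive_sum_fun (fun k =>
  is_derive_mul (is_derive_expmx A t i k) (H k tT))) _.
rewrite big_split/= mxE; congr (_ + _).
  rewrite /lti_response mulmxA [RHS]mxE; apply: eq_bigr => k _.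
  by rewrite [X in _ = _ * X]mxE.
have -> : \sum_k expmx A t i k * (expmx A (- t) *m r t) k 0 =
    (expmx A t *m (expmx A (- t) *m r t)) i 0 by rewrite [RHS]mxE.
by rewrite mulmxA expmxN mul1mx.
Qed.

End response.

Lemma integrable_measurable (R : realType) (D : set R) (g : R -> R) :
  (@lebesgue_measure R).-integrable D (EFin \o g) -> measurable_fun D g.
Proof. by move=> /integrableP[/measurable_EFinP]. Qed.

Lemma measurable_half_line_set (R : realType) :
  measurable (half_line : set (measurableTypeR R)).
Proof. exact: measurable_itv. Qed.
#[local] Hint Resolve measurable_half_line_set : core.

Section half_line_integrals.
Variable R : realType.
Notation mu := (@lebesgue_measure R).

Lemma sub_half_line (T : R) : `[0, T]%classic `<=` (half_line : set R).
Proof. by move=> t /=; rewrite /half_line/= !in_itv/= andbT => /andP[]. Qed.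

Let half_line_cvg (g : R -> R) :
  (forall t, 0 <= g t) -> measurable_fun half_line g ->
  (\int[mu]_(t in `[0%R, n.+1%:R]) (g t)%:E @[n --> \oo] -->
   \int[mu]_(t in half_line) (g t)%:E)%E.
Proof.
move=> g0 mg; rewrite half_line_bigcup.
apply: ge0_nondecreasing_set_cvg_integral => //.
- apply/nondecreasing_seqP => n; rewrite subsetEset.
  by apply: subset_itvl; rewrite bnd_simp ler_nat.
- move=> n; apply/measurable_EFinP; apply: measurable_funS mg; [exact: measurable_half_line_set|exact: sub_half_line].
- by move=> n t _; rewrite lee_fin.
Qed.

Lemma half_line_integral_le (g : R -> R) (C : R) :
  (forall t, 0 <= g t) ->
  (forall T, 0 < T -> mu.-integrable `[0, T] (EFin \o g)) ->
  (forall T, 0 < T -> \int[mu]_(t in `[0, T]) g t <= C) ->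
  (\int[mu]_(t in half_line) (g t)%:E <= C%:E)%E.
Proof.
move=> g0 ig gC.
have mg : measurable_fun half_line g.
  by apply: measurable_half_line => T T0; exact: integrable_measurable (ig _ T0).
have H := half_line_cvg g0 mg.
rewrite -(cvg_lim _ H)//; apply: lime_le; first by apply/cvg_ex; eexists; exact: H.
apply: nearW => n; have n0 : 0 < n.+1%:R :> R by rewrite ltr0n.
rewrite -[leLHS]fineK ?lee_fin; first exact: gC.
exact: integrable_fin_num (ig _ n0).
Qed.

(** The tail integrals of |g| decrease with s, so a bound reached at one integer serves all later
    times. *)
Lemma half_line_tail (g : R -> R) (e : R) :
  mu.-integrable half_line (EFin \o g) -> 0 < e ->
  exists N : nat, forall s, N%:R <= s ->
    `|\int[mu]_(t in half_line) g t - \int[mu]_(t in `[0, s]) g t| <= e.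
Proof.
move=> ig e0.
have ig' := integrable_norm ig.
have H : (\int[mu]_(t in `[0%R, n.+1%:R]) (`|g t|%R)%:E @[n --> \oo] -->
   \int[mu]_(t in half_line) (`|g t|%R)%:E)%E.
  apply: half_line_cvg => //; apply: measurableT_comp => //.
  exact: integrable_measurable ig.
have ign T : mu.-integrable `[0, T] (EFin \o (fun t => `|g t|)).
  by apply: integrableS ig' => //; exact: sub_half_line.
have fin : (\int[mu]_(t in half_line) (`|g t|%R)%:E)%E \is a fin_num.
  exact: integrable_fin_num ig'.
rewrite -(fineK fin) in H; move/fine_cvgP: H => [_ /cvgrPdist_le/(_ _ e0)[N _ HN]].
(* Index N of the sequence refers to the interval [0, N + 1]. *)
exists N.+1 => s Ns.
have s0 : 0 <= s by apply: le_trans Ns.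
have split h T : 0 <= T -> mu.-integrable half_line (EFin \o h) ->
    \int[mu]_(t in half_line) h t - \int[mu]_(t in `[0, T]) h t =
    \int[mu]_(t in `]T, +oo[) h t.
  by move=> T0 ih; apply: Rintegral_itvB => //; rewrite bnd_simp.
rewrite split//.
have igs : mu.-integrable `]s, +oo[ (EFin \o g).
  apply: integrableS ig => // t /=; rewrite /half_line/= !in_itv/= !andbT.
  by move=> /ltW; exact: le_trans.
apply: le_trans (le_normr_Rintegral _ igs) _ => //.
rewrite -split//.
have := HN N (leqnn _) => /=.
apply: le_trans; apply: le_trans (ler_norm _); rewrite lerD2l lerN2.
rewrite (Rintegral_itv_split (ign s) _ Ns)//.
by rewrite lerDl; apply: Rintegral_ge0.
Qed.

End half_line_integrals.

Lemma sq_integrable_L2 (R : realType) (D : set (measurableTypeR R)) (n : nat)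
    (r : R -> 'cV[R]_n) :
  measurable D -> sq_integrable_cV D r -> L2 D r.
Proof.
move=> mD sr; split=> [i|]; first by have [] := sr i.
have := integrable_fin_num mD (integrable_sqnorm mD sr).
rewrite /L2norm; set I := (\int[_]_(t in D) _)%E => Ifin.
by rewrite -(fineK Ifin)/= ltry.
Qed.

Lemma truncation_sq_integrable (R : realType) (T : R) (n : nat) (r : R -> 'cV[R]_n) :
  sq_integrable_cV `[0, T] r -> sq_integrable_cV half_line (truncation T r).
Proof.
move=> sr i; have [mr ir] := sr i.
have E : (fun t => truncation T r t i 0) = (fun t => r t i 0) \_ `[0, T].
  apply/funext => t; rewrite /truncation patchE.
  by case: ifPn => tT; [rewrite mem_set|rewrite memNset ?mxE//; exact/negP].
have sub : (half_line : set R) `&` `[0, T] = `[0, T]%classic.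
  by rewrite setIC; apply/setIidPl; exact: sub_half_line.
split; first by rewrite E; apply/measurable_restrict => //; rewrite sub.
have -> : EFin \o (fun t => truncation T r t i 0 ^+ 2) =
    (EFin \o (fun t => r t i 0 ^+ 2)) \_ `[0, T].
  apply/funext => t; have /= := congr1 (fun f => f t) E => ->.
  by rewrite !patchE; case: ifPn => //= _; rewrite expr0n.
by apply/integrable_restrict => //; rewrite sub.
Qed.

Lemma dot_young (R : realType) (n : nat) (e : R) (x y : 'cV[R]_n) : 0 < e ->
  2 * (x^T *m y) 0 0 <= e * sqnorm x + sqnorm y / e.
Proof.
move=> e0; rewrite !sqnormE mxE !mulr_sumr mulr_suml -big_split/=.
apply: ler_sum => i _; rewrite mxE -subr_ge0.
have -> : e * x i 0 ^+ 2 + y i 0 ^+ 2 / e - 2 * (x i 0 * y i 0) =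
    (e * x i 0 - y i 0) ^+ 2 / e by field; rewrite gt_eqF.
by rewrite divr_ge0 ?sqr_ge0// ltW.
Qed.

(** Along the response x, [qform X x] has derivative at most - 2 e |x|^2 + 2 x . X r, hence at most
    - e |x|^2 + |X r|^2 / e by Young. Integrating from the state 0 and using X >= 0 bounds the
    integral of |x|^2 by that of |X r|^2 over e^2, uniformly in T. *)
Lemma hurwitz_response_sq_integrable (R : realType) (n : nat) (A : 'M[R]_n)
    (r : R -> 'cV[R]_n) :
  hurwitz A -> sq_integrable_cV half_line r ->
  sq_integrable_cV half_line (lti_response A r).
Proof.
move=> /lyapunov[X [XT X0 [e e0 Xe]]] sr; pose mu := @lebesgue_measure R.
have srT T : sq_integrable_cV `[0, T] r.
  exact: (sq_integrableS (measurable_itv _) (@measurable_half_line_set R)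
    (@sub_half_line R T) sr).
set x := lti_response A r.
have acx T : ac_on 0 T x by apply: lti_response_ac.
have sxT T : sq_integrable_cV `[0, T] x by apply: ac_on_sq_integrable.
have sXr T := sq_integrable_mulmx (measurable_itv _) X (srT T).
have sXrh : sq_integrable_cV half_line (fun t => X *m r t).
  by apply: sq_integrable_mulmx.
have ixT T := integrable_sqnorm (measurable_itv _) (sxT T).
have irT T := integrable_sqnorm (measurable_itv _) (sXr T).
have irh := integrable_sqnorm (measurable_itv _) sXrh.
apply: sqnorm_integrable_sq => //.
  move=> i; apply: measurable_half_line => T _.
  by apply: ac_on_measurable; exact: ac_on_coord.
pose B := \int[mu]_(t in half_line) sqnorm (X *m r t).
apply: (@le_lt_trans _ _ (B / e / e)%:E); last exact: ltry.
apply: half_line_integral_le => [t|T _|T T0]; [exact: sqnorm_ge0|exact: ixT|].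
have := @ac_on_le_integral _ 0 T (fun t => qform X (x t))
  (fun t => e^-1 * sqnorm (X *m r t) - e * sqnorm (x t)) (ltW T0)
  (ac_on_qform X (acx T)).
have H := integrable_sub (measurable_itv _)
  (integrable_scale (measurable_itv _) e^-1 (irT T))
  (integrable_scale (measurable_itv _) e (ixT T)).
move=> /(_ H){H}.
rewrite RintegralB; [|by []|exact: integrable_scale (irT T)|exact: integrable_scale (ixT T)].
rewrite RintegralZl; [|by []|exact: irT].
rewrite RintegralZl; [|by []|exact: ixT].
have BT : \int[mu]_(t in `[0, T]) sqnorm (X *m r t) <= B.
  rewrite /B -subr_ge0 [half_line]/(half_line).
  rewrite (@Rintegral_itvB _ _ (BLeft 0) +oo%O T)//; last by rewrite bnd_simp ltW.
  by apply: Rintegral_ge0 => t _; exact: sqnorm_ge0.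
rewrite [x 0]lti_response0.
have -> : qform X 0 = 0 by rewrite /qform mulmx0 mxE.
rewrite subr0 => H.
have {}H : 0 <= e^-1 * B - e * \int[mu]_(t in `[0, T]) sqnorm (x t).
  apply: le_trans (X0 (x T)) (le_trans (H _) _); last first.
    by rewrite lerD2r ler_wpM2l// invr_ge0 ltW.
  have := lti_response_derive A (srT T); apply: filterS => t dx tT.
  have {}dx := is_derive_qform XT (dx tT); eexists; last exact: dx.
  have -> : ((x t)^T *m X *m (A *m x t + r t)) 0 0 =
      ((x t)^T *m X *m (A *m x t)) 0 0 + ((x t)^T *m (X *m r t)) 0 0.
    by rewrite mulmxDr mxE (mulmxA _ X).
  have := Xe (x t); have := dot_young (x t) (X *m r t) e0.
  by rewrite [sqnorm (X *m r t) / e]mulrC; lra.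
by rewrite ler_pdivlMr// mulrC [B / e]mulrC -subr_ge0.
Qed.

(** * From the soft IQC to a bound at finite times *)

(** The LMI tested on the stacked vector (x, w). When v = 0 the left-hand side is the derivative of
    [qform Y] along the filter plus [qform M z]. *)
Lemma filter_LMI_le (R : realType) (npsi nv nw nz : nat)
    (Psi : lti_filter R npsi nv nw nz) (M : 'M[R]_nz) (Y : 'M[R]_npsi)
    (x : 'cV[R]_npsi) (w : 'cV[R]_nw) :
  Y^T = Y -> filter_LMI Psi M Y ->
  2 * (x^T *m Y *m (psi_A Psi *m x + psi_B2 Psi *m w)) 0 0 +
    qform M (psi_C Psi *m x + psi_D2 Psi *m w) <= 0.
Proof.
move=> YT [_ H].
set A := psi_A Psi; set B := psi_B2 Psi; set C := psi_C Psi; set D := psi_D2 Psi.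
have {H} : qform (block_mx (A^T *m Y + Y *m A) (Y *m B) (B^T *m Y) 0 +
    (row_mx C D)^T *m M *m row_mx C D) (col_mx x w) <= 0.
  have [->|/H/ltW//] := eqVneq (col_mx x w) 0.
  by rewrite /qform mulmx0 mxE.
rewrite /qform mulmxDr mulmxDl mxE; apply: le_trans; rewrite le_eqVlt; apply/orP; left.
apply/eqP; congr (_ + _); last first.
  rewrite !mulmxA -trmx_mul mul_row_col -!mulmxA mul_row_col.
  by rewrite !mulmxA.
rewrite tr_col_mx mul_row_block mulmx0 addr0 mul_row_col.
have tr (Z : 'M[R]_1) : Z 0 0 = Z^T 0 0 by rewrite mxE.
have addE (Z1 Z2 : 'M[R]_1) : (Z1 + Z2) 0 0 = Z1 0 0 + Z2 0 0 by rewrite mxE.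
have E1 : (x^T *m A^T *m Y *m x) 0 0 = (x^T *m Y *m A *m x) 0 0.
  by rewrite [LHS]tr !trmx_mul !trmxK YT !mulmxA.
have E2 : (w^T *m B^T *m Y *m x) 0 0 = (x^T *m Y *m B *m w) 0 0.
  by rewrite [LHS]tr !trmx_mul !trmxK YT !mulmxA.
rewrite !(mulmxDl, mulmxDr) !mulmxA !addE E1 E2; ring.
Qed.

Lemma qform_bound (R : realType) (n : nat) (Y : 'M[R]_n) :
  exists2 C, 0 <= C & forall x : 'cV[R]_n, `|qform Y x| <= C * sqnorm x.
Proof.
exists (\sum_i \sum_j `|Y i j|).
  by apply: sumr_ge0 => i _; exact: sumr_ge0.
move=> x; rewrite qform_mx mulr_suml (le_trans (ler_norm_sum _ _ _))//.
apply: ler_sum => i _; rewrite mulr_suml (le_trans (ler_norm_sum _ _ _))//.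
apply: ler_sum => j _; rewrite !normrM mulrAC [_ * `|Y i j|]mulrC ler_wpM2l//.
have := sqnorm_ge_coord x i; have := sqnorm_ge_coord x j.
rewrite -(real_normK (num_real (x i 0))) -(real_normK (num_real (x j 0))).
by have := sqr_ge0 (`|x i 0| - `|x j 0|); nra.
Qed.

(** If g >= d from m on, a late interval of length 1 would contribute at least d, although the tails
    at its two ends are at most d / 4. Applied to the squared norm of the filter state, this yields
    late times at which the state is small, without a limit at infinity. *)
Lemma half_line_small (R : realType) (g : R -> R) (d m : R) :
  (forall t, 0 <= g t) -> (@lebesgue_measure R).-integrable half_line (EFin \o g) ->
  0 < d -> exists2 s, m <= s & g s < d.
Proof.
move=> g0 ig d0; apply: contrapT => nex.
have gd s : m <= s -> d <= g s.
  by move=> ms; rewrite leNgt; apply/negP => gs; apply: nex; exists s.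
have d4 : 0 < d / 4 by rewrite divr_gt0.
have [N HN] := half_line_tail ig d4.
pose a := Num.max m N%:R; pose b := a + 1.
have Na : N%:R <= a by rewrite le_max lexx orbT.
have ab : a <= b by rewrite lerDl.
have a0 : 0 <= a by apply: le_trans Na.
have ib : (@lebesgue_measure R).-integrable `[0, b] (EFin \o g).
  by apply: (integrableS (@measurable_half_line_set R)) ig => //; exact: sub_half_line.
have iab : (@lebesgue_measure R).-integrable `[a, b] (EFin \o g).
  by apply: integrableS ib => //; apply: subset_itvr; rewrite bnd_simp.
have := HN b (le_trans Na ab); have := HN a Na.
rewrite (Rintegral_itv_split ib a0 ab) !ler_norml => /andP[? ?] /andP[? ?].
have : d <= \int[@lebesgue_measure R]_(t in `[a, b]) g t; last by lra.
have ic : (@lebesgue_measure R).-integrable `[a, b] (EFin \o (fun=> d)).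
  apply: sq_integrable_integrable => //; first exact: lebesgue_itvcc_fin.
  apply: (@sq_integrable_bounded _ _ _ _ `|d|) => //.
  exact: lebesgue_itvcc_fin.
have -> : d = \int[@lebesgue_measure R]_(t in `[a, b]) d.
  rewrite Rintegral_cst//= lebesgue_measure_itv/= lte_fin ifT ?ltrDl//.
  by rewrite /b /= addrAC subrr add0r mulr1.
apply: le_Rintegral => // t; rewrite /= in_itv/= => /andP[at_ _].
by apply: gd; apply: le_trans at_; rewrite le_max lexx.
Qed.

Section iqc.
Variables (R : realType) (npsi nv nw nz : nat) (Psi : lti_filter R npsi nv nw nz).
Notation mu := (@lebesgue_measure R).

Definition filter_state (v : R -> 'cV[R]_nv) (w : R -> 'cV[R]_nw) : R -> 'cV[R]_npsi :=
  lti_response (psi_A Psi) (fun t => psi_B1 Psi *m v t + psi_B2 Psi *m w t).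

Lemma filter_input_sq_integrable (D : set (measurableTypeR R)) v w :
  measurable D -> sq_integrable_cV D v -> sq_integrable_cV D w ->
  sq_integrable_cV D (fun t => psi_B1 Psi *m v t + psi_B2 Psi *m w t).
Proof.
by move=> mD sv sw; apply: sq_integrable_cVD => //; exact: sq_integrable_mulmx.
Qed.

Lemma filter_output_sq_integrable (D : set (measurableTypeR R)) x v w :
  measurable D -> sq_integrable_cV D x -> sq_integrable_cV D v ->
  sq_integrable_cV D w -> sq_integrable_cV D (fun t => psi_out Psi (x t) (v t) (w t)).
Proof.
move=> mD sx sv sw; apply: sq_integrable_cVD => //; last exact: sq_integrable_mulmx.
by apply: sq_integrable_cVD => //; exact: sq_integrable_mulmx.
Qed.

Lemma filter_state_derive (T : R) v w :
  sq_integrable_cV `[0, T] v -> sq_integrable_cV `[0, T] w ->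
  {ae mu, forall t : R, 0 <= t <= T ->
    is_derive t 1 (filter_state v w) (psi_rhs Psi (filter_state v w t) (v t) (w t))}.
Proof.
move=> sv sw; have := lti_response_derive (psi_A Psi)
  (filter_input_sq_integrable (measurable_itv _) sv sw).
by apply: filterS => t H tT; rewrite /psi_rhs -addrA; exact: H.
Qed.

Lemma filter_state_ac (T : R) v w :
  sq_integrable_cV `[0, T] v -> sq_integrable_cV `[0, T] w ->
  ac_on 0 T (filter_state v w).
Proof.
move=> sv sw; apply: lti_response_ac.
exact: (filter_input_sq_integrable (measurable_itv _) sv sw).
Qed.

Let restrict (n : nat) (r : R -> 'cV[R]_n) (a b : R) :
  0 <= a -> sq_integrable_cV half_line r -> sq_integrable_cV `[a, b] r.
Proof.
move=> a0; apply: (sq_integrableS (measurable_itv _) (@measurable_half_line_set R)).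
by move=> t /=; rewrite /half_line/= !in_itv/= andbT => /andP[/(le_trans a0)].
Qed.

(** The soft IQC quantifies over trajectories of the filter, so one has to be exhibited before it
    yields anything. *)
Lemma filter_trajectory v w :
  sq_integrable_cV half_line v -> sq_integrable_cV half_line w ->
  psi_trajectory Psi v w (filter_state v w).
Proof.
move=> sv sw; split.
- exact: lti_response0.
- by move=> T _; apply: filter_state_ac; exact: restrict.
have H n : {ae mu, forall t : R, 0 <= t <= n%:R -> is_derive t 1 (filter_state v w)
    (psi_rhs Psi (filter_state v w t) (v t) (w t))}.
  by apply: filter_state_derive; exact: restrict.
have := ae_foralln H; apply: filterS => t Ht t0.
by apply: (Ht (Num.truncn t).+1); rewrite t0/= ltW// truncnS_gt.
Qed.

Hypothesis hA : hurwitz (psi_A Psi).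
Variables (M : 'M[R]_nz) (Y : 'M[R]_npsi).
Hypotheses (YT : Y^T = Y) (LMI : filter_LMI Psi M Y).

(* After time tau the filter is driven by w only, so the LMI makes
   [qform Y x + int qform M z] nonincreasing; since the filter state tends to 0
   along a sequence of times, the tail of the integral is at most
   [qform Y (x tau)]. *)
Lemma filter_tail_bound v w (tau : R) : 0 <= tau ->
  sq_integrable_cV half_line v -> sq_integrable_cV half_line w ->
  (forall t, tau < t -> v t = 0) ->
  let x := filter_state v w in
  let z t := psi_out Psi (x t) (v t) (w t) in
  (\int[mu]_(t in half_line) qform M (z t) <=
   \int[mu]_(t in `[0, tau]) qform M (z t) + qform Y (x tau) : Prop).
Proof.
move=> tau0 sv sw v0 x z.
have sx : sq_integrable_cV half_line x.
  apply: hurwitz_response_sq_integrable => //.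
  exact: (filter_input_sq_integrable (@measurable_half_line_set R) sv sw).
have sz : sq_integrable_cV half_line z.
  exact: (filter_output_sq_integrable (@measurable_half_line_set R) sx sv sw).
have iq := integrable_qform (@measurable_half_line_set R) M sz.
have iqT a b : 0 <= a -> mu.-integrable `[a, b] (EFin \o (fun t => qform M (z t))).
  by move=> a0; exact: (integrable_qform (measurable_itv _) M (restrict _ a0 sz)).
have ix := integrable_sqnorm (@measurable_half_line_set R) sx.
have step s : tau <= s ->
    \int[mu]_(t in `[tau, s]) qform M (z t) <= qform Y (x tau) - qform Y (x s).
  move=> ts.
  have acx : ac_on tau s x.
    apply: (ac_on_sub tau0 (lexx s)); apply: filter_state_ac; exact: restrict.
  have iN : mu.-integrable `[tau, s] (EFin \o (fun t => - 1 * qform M (z t))).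
    exact: (integrable_scale (measurable_itv _) _ (iqT _ _ tau0)).
  have := ac_on_le_integral ts (ac_on_qform Y acx) iN.
  rewrite RintegralZl; [|by []|exact: iqT] => H.
  suff : qform Y (x s) - qform Y (x tau) <= - 1 * \int[mu]_(t in `[tau, s]) qform M (z t).
    by lra.
  apply: H; have := filter_state_derive (restrict s (lexx 0) sv) (restrict s (lexx 0) sw).
  (* The time [tau] is excluded because [v] is known to vanish only strictly after it. *)
  move: (ae_neq tau); apply: filterS2 => t ttau dx /andP[tt ts'].
  have {}dx : is_derive t 1 x (psi_rhs Psi (x t) (v t) (w t)).
    by apply: dx; rewrite (le_trans tau0 tt) ts'.
  have {}tt : tau < t by rewrite lt_neqAle eq_sym ttau.
  eexists; last exact: (is_derive_qform YT dx).
  rewrite -/x /z (v0 t tt) /psi_rhs /psi_out !mulmx0 !addr0.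
  by have := filter_LMI_le (x t) (w t) YT LMI; lra.
apply/ler_addgt0Pr => e e0.
have [C C0 HC] := qform_bound Y.
have [N HN] := half_line_tail iq (divr_gt0 e0 (ltr0n R 2)).
(* Makes |qform Y (x s)| at most e / 2, the other half of e being spent on the tail of the integral;
   C + 1 avoids division by C = 0. *)
have d0 : 0 < e / (2 * (C + 1)) by rewrite divr_gt0// mulr_gt0// ltr_wpDl.
have [s] := half_line_small (Num.max tau N%:R) (fun t => sqnorm_ge0 (x t)) ix d0.
rewrite ge_max => /andP[ts Ns] xs.
have := HN s Ns; rewrite ler_norml => /andP[_].
have s0 : 0 <= s by exact: le_trans ts.
rewrite (Rintegral_itv_split (iqT _ _ (lexx 0)) tau0 ts).
have : `|qform Y (x s)| <= e / 2.
  apply: le_trans (HC (x s)) _; move: xs; rewrite ltr_pdivlMr ?mulr_gt0 ?ltr_wpDl//.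
  by have := sqnorm_ge0 (x s); lra.
rewrite ler_norml => /andP[? _]; have := step s ts.
by lra.
Qed.

Variable Delta : (R -> 'cV[R]_nv) -> (R -> 'cV[R]_nw).
Hypotheses (hDelta : bounded_causal_operator Delta) (hIQC : soft_IQC Psi M Delta).

(** A hard IQC with terminal cost: the integral up to [tau] may be negative, but by no more than
    [qform Y] of the filter state. *)
Lemma soft_IQC_hard_bound v (tau : R) : 0 <= tau -> L2 half_line v ->
  let x := filter_state v (Delta v) in
  (0 <= \int[mu]_(t in `[0, tau]) qform M (psi_out Psi (x t) (v t) (Delta v t)) +
        qform Y (x tau) : Prop).
Proof.
move=> tau0 Lv x; have [DL2 _ _ Dcausal] := hDelta.
have sv := L2_sq_integrable (@measurable_half_line_set R) Lv.
have sw := L2_sq_integrable (@measurable_half_line_set R) (DL2 _ Lv).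
pose v' := truncation tau v.
have sv' : sq_integrable_cV half_line v'.
  by apply: truncation_sq_integrable; exact: restrict.
have Lv' : L2 half_line v' by exact: (sq_integrable_L2 (@measurable_half_line_set R) sv').
have sw' := L2_sq_integrable (@measurable_half_line_set R) (DL2 _ Lv').
pose x' := filter_state v' (Delta v').
have v'0 t : tau < t -> v' t = 0.
  by move=> tt; rewrite /v' /truncation [t <= tau]leNgt tt andbF.
have vv' t : 0 <= t <= tau -> v' t = v t by rewrite /v' /truncation => ->.
have ww' : {ae mu, forall t : R, 0 <= t <= tau -> Delta v t = Delta v' t} by exact: Dcausal.
have r0 n (r : R -> 'cV[R]_n) : sq_integrable_cV half_line r -> sq_integrable_cV `[0, tau] r.
  exact: restrict.
(* Pointwise equality matters here: the terminal term uses the state at the single time [tau]. *)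
have xx' t : t <= tau -> x' t = x t.
  move=> tt; apply: (@eq_lti_response _ _ _ _ _ tau t) => //.
  - exact: (filter_input_sq_integrable (measurable_itv _) (r0 _ _ sv') (r0 _ _ sw')).
  - exact: (filter_input_sq_integrable (measurable_itv _) (r0 _ _ sv) (r0 _ _ sw)).
  by apply: filterS ww' => s ws st; rewrite (vv' s st) (ws st).
have := filter_tail_bound tau0 sv' sw' v'0.
rewrite /= -/x' (xx' tau (lexx _)) => tail.
have := hIQC Lv' (filter_trajectory sv' sw'); rewrite -/x'.
have sx' : sq_integrable_cV half_line x'.
  apply: hurwitz_response_sq_integrable => //.
  exact: (filter_input_sq_integrable (@measurable_half_line_set R) sv' sw').
have iq' := integrable_qform (@measurable_half_line_set R) M
  (filter_output_sq_integrable (@measurable_half_line_set R) sx' sv' sw').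
(* The IQC is an inequality between extended reals; stability of the filter makes the integral
   finite, so it can be compared with the real-valued tail bound. *)
have := integrable_fin_num (@measurable_half_line_set R) iq' => fin.
rewrite -(fineK fin) lee_fin => q0.
apply: le_trans (le_trans q0 tail) _; rewrite lerD2r le_eqVlt; apply/orP; left; apply/eqP.
have acx : ac_on 0 tau x by apply: filter_state_ac; exact: restrict.
have sx := ac_on_sq_integrable acx.
have iq := integrable_qform (measurable_itv _) M
  (filter_output_sq_integrable (measurable_itv _) sx (r0 _ _ sv) (r0 _ _ sw)).
have iq'' := integrable_qform (measurable_itv _) M
  (filter_output_sq_integrable (measurable_itv _) (r0 _ _ sx') (r0 _ _ sv') (r0 _ _ sw')).
congr fine; apply: ae_eq_integral => //.
- exact: measurable_int iq''.
- exact: measurable_int iq.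
apply: filterS ww' => s ws /=; rewrite in_itv/= => st.
have [s0 stau] := andP st.
by rewrite (vv' s st) (ws st) (xx' s stau).
Qed.

End iqc.

(** * The closed loop *)

(** Condition (i) uses partial derivatives, whereas the chain rule along the closed loop produces
    the total differential in the direction (1, dy, dyt). Each partial derivative is that
    differential composed with the inclusion of one coordinate slice. *)
Lemma diff_partial (R : realType) (nx nu : nat)
    (V : R -> 'cV[R]_nx -> 'cV[R]_nu -> R) (t : R)
    (y : 'cV[R]_nx) (yt : 'cV[R]_nu) (dy : 'cV[R]_nx) (dyt : 'cV[R]_nu) :
  differentiable (fun p : R * 'cV[R]_nx * 'cV[R]_nu => V p.1.1 p.1.2 p.2) (t, y, yt) ->
  'd (fun p : R * 'cV[R]_nx * 'cV[R]_nu => V p.1.1 p.1.2 p.2) (t, y, yt) (1, dy, dyt) =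
  derive1 (fun s => V s y yt) t + 'd (fun z => V t z yt) y dy + 'd (fun z => V t y z) yt dyt.
Proof.
set F := (fun p : R * 'cV[R]_nx * 'cV[R]_nu => V p.1.1 p.1.2 p.2) => dF.
have E1 : derive1 (fun s => V s y yt) t = 'd F (t, y, yt) (1, 0, 0).
  have H : is_derive t 1 (fun s : R => (s, y, yt)) (1, 0, 0).
    exact: (is_derive_pair (is_derive_pair (is_derive_id t 1) (is_derive_cst y t 1))
      (is_derive_cst yt t 1)).
  have := @is_derive_diff_comp _ _ _ F (fun s => (s, y, yt)) t _ dF H.
  by move=> [_ <-]; rewrite derive1E.
have E2 : 'd (fun z => V t z yt) y dy = 'd F (t, y, yt) (0, dy, 0).
  pose g (z : 'cV[R]_nx) : R * 'cV[R]_nx * 'cV[R]_nu := (t, z, yt).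
  have dg1 : differentiable (fun z : 'cV[R]_nx => (t, z) : R * 'cV[R]_nx) y.
    by apply: differentiable_pair.
  have dg : differentiable g y by apply: differentiable_pair.
  rewrite -[fun z => V t z yt]/(F \o g) (@diff_comp _ _ _ _ g F y dg dF)/=.
  rewrite /g diff_pair//= diff_pair//= !diff_cst.
  by rewrite (@diff_lin _ _ _ idfun)//=; move=> ?; exact: id.
have E3 : 'd (fun z => V t y z) yt dyt = 'd F (t, y, yt) (0, 0, dyt).
  pose g (z : 'cV[R]_nu) : R * 'cV[R]_nx * 'cV[R]_nu := (t, y, z).
  have dg : differentiable g yt by apply: differentiable_pair.
  rewrite -[fun z => V t y z]/(F \o g) (@diff_comp _ _ _ _ g F yt dg dF)/=.
  rewrite /g diff_pair//= !diff_cst.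
  by rewrite (@diff_lin _ _ _ idfun)//=; move=> ?; exact: id.
rewrite E1 E2 E3 -!linearD; congr ('d F _ _).
by rewrite -[RHS]/(1 + 0 + 0, 0 + dy + 0, 0 + 0 + dyt) !addr0 !add0r.
Qed.

Lemma ac_on_col_mx (R : realType) (a b : R) (m n : nat) (x : R -> 'cV[R]_m)
    (y : R -> 'cV[R]_n) :
  ac_on a b x -> ac_on a b y -> ac_on a b (fun t => col_mx (x t) (y t)).
Proof.
move=> acx acy; apply: ac_on_mx => i j; case: (split_ordP i) => k ->.
  by under eq_fun do rewrite col_mxEu; exact: ac_on_coord.
by under eq_fun do rewrite col_mxEd; exact: ac_on_coord.
Qed.

Lemma is_derive_col_mx (R : realType) (m n : nat) (x : R -> 'cV[R]_m)
    (y : R -> 'cV[R]_n) (t : R) dx dy :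
  is_derive t 1 x dx -> is_derive t 1 y dy ->
  is_derive t 1 (fun s => col_mx (x s) (y s)) (col_mx dx dy).
Proof.
move=> /is_derive_mx Hx /is_derive_mx Hy; apply/is_derive_mx => i j.
case: (split_ordP i) => k ->.
  by rewrite col_mxEu; under eq_fun do rewrite col_mxEu; exact: Hx.
by rewrite col_mxEd; under eq_fun do rewrite col_mxEd; exact: Hy.
Qed.

Lemma L2norm_lt (R : realType) (D : set R) (n : nat) (r : R -> 'cV[R]_n) (c : R) :
  0 < c -> (L2norm D r < c%:E)%E ->
  \int[@lebesgue_measure R]_(t in D) sqnorm (r t) < c ^+ 2.
Proof.
move=> c0; rewrite /L2norm /Rintegral; case: (integral _ _ _) => [I|//|_].
  rewrite /= lte_fin => Ic; have [I0|I0] := leP 0 I; last first.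
    by apply: lt_trans I0 _; exact: exprn_gt0.
  by rewrite -(sqr_sqrtr I0) ltrXn2r// nnegrE ?sqrtr_ge0// ltW.
by rewrite /= exprn_gt0.
Qed.

(** Invariance of the sublevel set, separated from the constraint sets. The filter state is
    existentially quantified because a solution of the uncertain system does not include one. *)
Lemma closed_loop_bound (R : realType) (nG nu nd nv nw npsi nz : nat)
  (G : plant R nG nu nd nv nw)
  (Delta : (R -> 'cV[R]_nv) -> (R -> 'cV[R]_nw))
  (hDelta : bounded_causal_operator Delta)
  (T rad gamma : R) (hrad : 0 < rad)
  (Psi : lti_filter R npsi nv nw nz) (hPsi : hurwitz (psi_A Psi))
  (M : 'M[R]_nz) (hIQC : soft_IQC Psi M Delta)
  (V : R -> 'cV[R]_(nG + npsi) -> 'cV[R]_nu -> R)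
  (hV : C1 (fun p : R * 'cV[R]_(nG + npsi) * 'cV[R]_nu => V p.1.1 p.1.2 p.2))
  (Y : 'M[R]_npsi) (hY : Y^T = Y) (hLMI : filter_LMI Psi M Y)
  (k : R -> 'cV[R]_nG -> 'cV[R]_nu -> 'cV[R]_nu)
  (hi : forall (t : R) x xt w d, 0 <= t <= T ->
     V t x xt - qform Y (dsubmx x) <= gamma + rad ^+ 2 ->
     derive1 (fun s => V s x xt) t
     + 'd (fun y => V t y xt) x (ext_F G Psi x w d xt)
     + 'd (fun y => V t x y) xt (k t (usubmx x) xt)
     + qform M (ext_H G Psi x w d xt) <= sqnorm d)
  (d : R -> 'cV[R]_nd) (v : R -> 'cV[R]_nv) (w : R -> 'cV[R]_nw)
  (xG : R -> 'cV[R]_nG) (xc : R -> 'cV[R]_nu) :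
  admissible_dist T rad d -> V 0 (col_mx (xG 0) 0) (xc 0) <= gamma ->
  ac_on 0 T xG -> ac_on 0 T xc -> L2 `[0, T]%classic v ->
  {ae @lebesgue_measure R, forall t : R, 0 <= t <= T -> w t = Delta (truncation T v) t} ->
  {ae @lebesgue_measure R, forall t : R, 0 <= t <= T ->
     [/\ is_derive t 1 xG (pl_f G (xG t) (w t) (d t) + pl_g G (xG t) (w t) (d t) *m xc t),
         v t = pl_h G (xG t) (w t) (d t) (xc t)
       & is_derive t 1 xc (k t (xG t) (xc t))]} ->
  exists xpsi : R -> 'cV[R]_npsi, forall t, 0 <= t <= T ->
    V t (col_mx (xG t) (xpsi t)) (xc t) - qform Y (xpsi t) <= gamma + rad ^+ 2.
Proof.
move=> [Ld nd_] V0 acG acc Lv wD dyn; pose mu := @lebesgue_measure R.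
have sv := L2_sq_integrable (measurable_itv _) Lv.
have sd := L2_sq_integrable (measurable_itv _) Ld.
(* [v] is square integrable on [0, T] only, while [Delta] and the IQC concern the half-line. On
   [0, T] the pair [vT], [Delta vT] equals [v], [w] almost everywhere. *)
pose vT := truncation T v.
have svT : sq_integrable_cV half_line vT by exact: truncation_sq_integrable.
have LvT : L2 half_line vT by exact: (sq_integrable_L2 (@measurable_half_line_set R) svT).
have swT : sq_integrable_cV half_line (Delta vT).
  apply: (L2_sq_integrable (@measurable_half_line_set R)).
  by have [H _ _ _] := hDelta; exact: H.
pose xpsi := filter_state Psi vT (Delta vT); exists xpsi.
have res n (r : R -> 'cV[R]_n) t : sq_integrable_cV half_line r -> sq_integrable_cV `[0, t] r.
  apply: (sq_integrableS (measurable_itv _) (@measurable_half_line_set R)).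
  exact: sub_half_line.
have acp : ac_on 0 T xpsi by apply: filter_state_ac; exact: res.
have xpsi0 : xpsi 0 = 0 by exact: lti_response0.
pose x t := col_mx (xG t) (xpsi t).
pose F := (fun p : R * 'cV[R]_(nG + npsi) * 'cV[R]_nu => V p.1.1 p.1.2 p.2).
pose q (t : R) := (t, x t, xc t).
have acq : ac_on 0 T q.
  apply: ac_on_pair => //; apply: ac_on_pair; first exact: ac_on_id.
  exact: ac_on_col_mx.
pose z t := psi_out Psi (xpsi t) (vT t) (Delta vT t).
have bU : locally_bounded_forms (R * 'cV[R]_(nG + npsi) * 'cV[R]_nu)%type.
  apply: locally_bounded_forms_pair; last exact: locally_bounded_forms_cV.
  apply: locally_bounded_forms_pair; last exact: locally_bounded_forms_cV.
  exact: locally_bounded_forms_R.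
have iz t : t <= T -> mu.-integrable `[0, t] (EFin \o (fun s => qform M (z s))).
  move=> tT; apply: (integrable_qform (measurable_itv _)).
  apply: (filter_output_sq_integrable Psi (measurable_itv _)); try exact: res.
  by apply: ac_on_sq_integrable; exact: (ac_on_sub (lexx 0) tT acp).
have idT := integrable_sqnorm (measurable_itv _) sd.
have id_ t : t <= T -> mu.-integrable `[0, t] (EFin \o (fun s => sqnorm (d s))).
  by move=> tT; apply: integrableS idT => //; apply: subset_itvl; rewrite bnd_simp.
have dT := L2norm_lt hrad nd_.
pose h t := F (q t) - qform Y (xpsi t).
(* The weak bound up to t improves itself to a strict one at t, because the energy of [d] is
   strictly below rad^2. *)
have bound t : 0 <= t <= T -> (forall s, 0 <= s <= t -> h s <= gamma + rad ^+ 2) ->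
    h t < gamma + rad ^+ 2.
  move=> /andP[t0 tT] Hs.
  have ig : mu.-integrable `[0, t] (EFin \o (fun s => sqnorm (d s) - qform M (z s))).
    exact: (integrable_sub (measurable_itv _) (id_ t tT) (iz t tT)).
  have := C1_le_integral bU hV t0 (ac_on_sub (lexx 0) tT acq) ig.
  rewrite RintegralB; [|by []|exact: id_|exact: iz] => H.
  have {}H : F (q t) - F (q 0) <= \int[mu]_(s in `[0, t]) sqnorm (d s) -
      \int[mu]_(s in `[0, t]) qform M (z s).
    apply: H; move: (filter_state_derive Psi (res _ _ T svT) (res _ _ T swT)) wD dyn.
    apply: filterS3 => s dpsi ws dyns /andP[s0 st].
    have sT : 0 <= s <= T by rewrite s0 (le_trans st).
    have [dxG vs dxc] := dyns sT; have {}ws := ws sT; have {}dpsi := dpsi sT.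
    have vTs : vT s = v s by rewrite /vT /truncation sT.
    have dx : is_derive s 1 x (ext_F G Psi (x s) (w s) (d s) (xc s)).
      rewrite /ext_F /x col_mxKu col_mxKd; apply: is_derive_col_mx => //.
      by rewrite -vs -vTs [w s]ws; exact: dpsi.
    exists (1, ext_F G Psi (x s) (w s) (d s) (xc s), k s (xG s) (xc s)).
      exact: (is_derive_pair (is_derive_pair (is_derive_id s 1) dx) dxc).
    have dFq := hV.1 (q s).
    rewrite (diff_partial _ _ dFq) lerBrDr.
    have -> : z s = ext_H G Psi (x s) (w s) (d s) (xc s).
      by rewrite /z /ext_H /x col_mxKu col_mxKd -vs -vTs [w s]ws.
    have := hi s (x s) (xc s) (w s) (d s) sT; rewrite /x col_mxKu col_mxKd; apply.
    by apply: Hs; rewrite s0.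
  have Hiqc := soft_IQC_hard_bound hPsi hY hLMI hDelta hIQC t0 LvT.
  have F0 : F (q 0) <= gamma by rewrite /F /q/= /x xpsi0.
  have dt : \int[mu]_(s in `[0, t]) sqnorm (d s) <= \int[mu]_(s in `[0, T]) sqnorm (d s).
    rewrite (Rintegral_itv_split idT t0 tT) lerDl.
    by apply: Rintegral_ge0 => s _; exact: sqnorm_ge0.
  have {}Hiqc : 0 <= \int[mu]_(s in `[0, t]) qform M (z s) + qform Y (xpsi t).
    exact: Hiqc.
  have {}dT : \int[mu]_(s in `[0, T]) sqnorm (d s) < rad ^+ 2 by exact: dT.
  rewrite /h; move: Hiqc H dt dT F0.
  set I1 := Rintegral _ _ _; set I2 := Rintegral _ _ _; set I3 := Rintegral _ _ _.
  by set f1 := F _; set f2 := F _; set Yx := qform _ _; set r2 := rad ^+ 2; lra.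
(* Continuity of [h] relative to [0, T], as the states are unconstrained outside that interval. *)
have cont t e : 0 <= t <= T -> 0 < e -> exists2 n, 0 < n &
    forall s, 0 <= s <= T -> `|s - t| < n -> `|h s - h t| < e.
  move=> tT e0; have e2 : 0 < e / 2 by rewrite divr_gt0.
  have cF : {for q t, continuous F} by apply: differentiable_continuous; exact: hV.1.
  move/cvgrPdist_lt : cF => /(_ _ e2)/nbhs_ballP[r /= r0 HF].
  have [n1 n10 H1] := ac_on_unif acq r0.
  have [n2 n20 H2] := ac_on_unif (ac_on_qform Y acp) e2.
  exists (Num.min n1 n2) => [|s sT]; first by rewrite lt_min n10.
  rewrite lt_min => /andP[s1 s2].
  have := H2 _ _ tT sT s2; have := HF (q s).
  rewrite -ball_normE/= distrC => /(_ (H1 _ _ tT sT s1)); rewrite distrC => h1 h2.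
  have -> : h s - h t = (F (q s) - F (q t)) - (qform Y (xpsi s) - qform Y (xpsi t)).
    by rewrite /h; ring.
  by rewrite (le_lt_trans (ler_normB _ _))// [ltRHS]splitr ltrD.
suff Hh : forall t, 0 <= t <= T -> h t <= gamma + rad ^+ 2 by [].
have r20 : 0 <= rad ^+ 2 by exact: sqr_ge0.
(* To the right of t, the strict bound and continuity leave room; from the left, the weak bound
   passes to the limit. *)
apply: real_induction.
- rewrite /h xpsi0 /qform mulmx0 [X in _ - X]mxE subr0 /F /q/= /x xpsi0.
  by apply: le_trans V0 _; rewrite lerDl.
- move=> t /andP[t0 tT] Ht.
  have tT' : 0 <= t <= T by rewrite t0 ltW.
  have ht := bound t tT' Ht.
  have e0 : 0 < gamma + rad ^+ 2 - h t by rewrite subr_gt0.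
  have [n n0 Hn] := cont t _ tT' e0; exists (t + n); first by rewrite ltrDl.
  move=> s /andP[ts stn] sT; have := Hn s; rewrite (le_trans t0 (ltW ts)) sT.
  rewrite gtr0_norm ?subr_gt0// ltrBlDl => /(_ isT stn).
  by rewrite ltr_norml => /andP[_]; rewrite ltrD2r => /ltW.
- move=> t /andP[t0 tT] Ht; rewrite leNgt; apply/negP => ht.
  have tT' : 0 <= t <= T by rewrite tT ltW.
  have e0 : 0 < h t - (gamma + rad ^+ 2) by rewrite subr_gt0.
  have [n n0 Hn] := cont t _ tT' e0.
  pose s := Num.max 0 (t - n / 2).
  have s0 : 0 <= s by rewrite le_max lexx.
  have st : s < t by rewrite gt_max t0/= ltrBlDr ltrDl divr_gt0.
  have sn : `|s - t| < n.
    rewrite ltr0_norm ?subr_lt0// opprB ltrBlDr addrC -ltrBlDr lt_max.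
    by apply/orP; right; lra.
  have := Ht s; rewrite s0 st => /(_ isT).
  have := Hn s; rewrite s0 (le_trans (ltW st) tT) => /(_ isT sn).
  by rewrite ltr_norml => /andP[+ _]; lra.
Qed.

Theorem theorem3 (R : realType) (nG nu nd nv nw npsi nz np : nat)
  (G : plant R nG nu nd nv nw)
  (Delta : (R -> 'cV[R]_nv) -> (R -> 'cV[R]_nw))
  (hDelta : bounded_causal_operator Delta)
  (T rad gamma : R) (hT : 0 < T) (hrad : 0 < rad)
  (XT : set 'cV[R]_nG) (P : 'M[R]_(np, nu)) (b : 'cV[R]_np)
  (Psi : lti_filter R npsi nv nw nz) (hPsi : hurwitz (psi_A Psi))
  (M : 'M[R]_nz) (hM : M^T = M)
  (hIQC : soft_IQC Psi M Delta)
  (V : R -> 'cV[R]_(nG + npsi) -> 'cV[R]_nu -> R)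
  (hV : C1 (fun p : R * 'cV[R]_(nG + npsi) * 'cV[R]_nu => V p.1.1 p.1.2 p.2))
  (Y22 : 'M[R]_npsi) (hY22 : Y22^T = Y22)
  (hLMI : filter_LMI Psi M Y22)
  (k : R -> 'cV[R]_nG -> 'cV[R]_nu -> 'cV[R]_nu) :
  let U := [set u : 'cV[R]_nu | forall i, (P *m u) i 0 <= b i 0] in
  let calV t x xt := V t x xt - qform Y22 (dsubmx x) in
  forall
  (hi : forall (t : R) x xt w d, 0 <= t <= T -> calV t x xt <= gamma + rad ^+ 2 ->
     derive1 (fun s => V s x xt) t
     + 'd (fun y => V t y xt) x (ext_F G Psi x w d xt)
     + 'd (fun y => V t x y) xt (k t (usubmx x) xt)
     + qform M (ext_H G Psi x w d xt) <= sqnorm d)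
  (hii : forall xpsi xt, U xt ->
     [set xG : 'cV[R]_nG | calV T (col_mx xG xpsi) xt <= gamma + rad ^+ 2]
       `<=` XT)
  (hiii : forall (i : 'I_np) (t : R) x xt, 0 <= t <= T ->
     calV t x xt <= gamma + rad ^+ 2 -> (row i P *m xt) 0 0 <= b i 0),
  let Omega := [set xi : 'cV[R]_nG | V 0 (col_mx xi 0) 0 <= gamma] in
  let K := integrated_controller k in
  Omega `<=` BRS_under T XT U rad G Delta K /\
  (forall xi, Omega xi -> closed_loop_exists T rad G Delta K xi ->
     BRS T XT U rad G Delta xi).
Proof.
move=> U calV hi hii hiii Omega K.
suff main : Omega `<=` BRS_under T XT U rad G Delta K.
  by split=> // xi Oxi ex; exists K => //; exact: main.
move=> xi Oxi d dR xG xc [[xG0 xc0] [acG acc] [v [w [Lv Lw wD dyn]]]].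
have V0 : V 0 (col_mx (xG 0) 0) (xc 0) <= gamma by rewrite xG0 xc0.
have [xpsi Hx] := closed_loop_bound hDelta hrad hPsi hIQC hV hY22 hLMI hi
  dR V0 acG acc Lv wD dyn.
(* The control constraint comes before the target set, since (ii) is available only for controller
   states in [U]. *)
have HU t : 0 <= t <= T -> U (xc t).
  move=> tT i; have := hiii i t (col_mx (xG t) (xpsi t)) (xc t) tT.
  rewrite /calV col_mxKd => /(_ (Hx t tT)).
  by rewrite !mxE; under eq_bigr do rewrite mxE.
split; first exact: HU.
have TT : 0 <= T <= T by rewrite ltW/=.
apply: (hii (xpsi T) (xc T) (HU T TT)).
by rewrite /calV/= col_mxKd; exact: Hx.
Qed.
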